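(* Let $(M,F)$ be an $m$-th root metric space with polynomial flag metric $h_{ij}=a_{ij i_3\dots i_m}(x)y^{i_3}\cdots y^{i_m}$, let $h_{ij\cdot k}=\partial h_{ij}/\partial y^k$, and let $|$ denote the horizontal covariant derivative of the canonical metrical connection ${}^hC\Gamma(N)$ attached to $h$. Then $(M,F)$ is a Berwald space if and only if $h_{ij\cdot k|l}=0$ for all $i,j,k,l$; and $(M,F)$ is a Landsberg space if and only if $h_{ij\cdot k|0}:=h_{ij\cdot k|l}\,y^l=0$ for all $i,j,k$.
   Context: Let $M$ be a smooth $n$-dimensional manifold with induced coordinates $(x^i,y^i)$ on $TM$. An $m$-th root metric space ($m\ge 2$) is $(M,F)$ with $F=\sqrt[m]{a_{i_1\dots i_m}(x)y^{i_1}\cdots y^{i_m}}$, where $a_{i_1\dots i_m}$ is totally symmetric and $g_{ij}=\frac12\frac{\partial^2F^2}{\partial y^i\partial y^j}$ is nondegenerate on $TM\setminus\{0\}$ (at the points where $F$ is defined and smooth); $g$ may have arbitrary signature. Then the matrix $(h_{ij})$ is also nondegenerate; $(h^{ij})$ denotes its inverse. Let $G^i$ be the canonical spray coefficients of $F$ (geodesics $\ddot x^i+2G^i(x,\dot x)=0$), $N^i_{\ j}=\partial G^i/\partial y^j$ the canonical nonlinear connection, and for $f=f(x,y)$ put $f_{;l}=\frac{\delta f}{\delta x^l}=\frac{\partial f}{\partial x^l}-N^r_{\ l}\frac{\partial f}{\partial y^r}$. The canonical metrical connection ${}^hC\Gamma(N)$ attached to $h$ has horizontal coefficients $L^i_{\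 jk}=\frac12h^{is}(h_{sj;k}+h_{sk;j}-h_{jk;s})$. The horizontal covariant derivative of a tensor $t_{ijk}(x,y)$ is $t_{ijk|l}=t_{ijk;l}-L^r_{\ il}t_{rjk}-L^r_{\ jl}t_{irk}-L^r_{\ kl}t_{ijr}$. The Berwald connection has horizontal coefficients $G^i_{\ jk}=\frac{\partial^2G^i}{\partial y^j\partial y^k}$. $(M,F)$ is a Berwald space if the $G^i_{\ jk}$ depend on $x$ alone. It is a Landsberg space if the Berwald connection is $h$-metrical, i.e. $g_{ij;k}-G^r_{\ ik}g_{rj}-G^r_{\ jk}g_{ir}=0$. *)

(* Defs.v *)
From HB Require Import structures.
From mathcomp Require Import all_boot all_order all_algebra.
From mathcomp Require Import all_classical all_reals all_analysis.
Set Implicit Arguments.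
Unset Strict Implicit.
Unset Printing Implicit Defensive.
Import Order.TTheory GRing.Theory Num.Theory.
Import numFieldNormedType.Exports.
Local Open Scope classical_set_scope.
Local Open Scope ring_scope.

(* [f] has iterated directional derivatives of all orders at [z], and all of
   them are differentiable there. On an open subset of a finite-dimensional
   space this is C^infinity; at a single point it is only meaningful when
   required on a neighbourhood. *)
Definition smooth_at (R : realType) (V : normedModType R) (f : V -> R)
    (z : V) : Prop :=
  forall s : seq V, differentiable (foldr (fun v g => 'D_v g) f s) z.

Definition smooth_on (R : realType) (V : normedModType R) (W : set V)
    (f : V -> R) : Prop :=
  forall z, W z -> smooth_at f z.

Definition basis_vec (R : realType) (n : nat) (i : 'I_n) : 'rV[R]_n :=
  delta_mx 0 i.

(* The atlas need not be maximal: notions below quantify over its charts.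
   [chart_inv c] is the inverse of [chart c]; both are total functions, relevant
   only on [chart_dom c] and [chart c @` chart_dom c]. *)
Record smooth_manifold (R : realType) (n : nat) := SmoothManifold {
  carrier :> topologicalType;
  hausdorff_carrier : hausdorff_space carrier;
  second_countable_carrier : @second_countable carrier;
  chart_index : Type;
  chart_dom : chart_index -> set carrier;
  chart : chart_index -> carrier -> 'rV[R]_n;
  chart_inv : chart_index -> 'rV[R]_n -> carrier;
  open_dom : forall c, open (chart_dom c);
  cover_dom : forall p, exists c, chart_dom c p;
  open_image : forall c, open (chart c @` chart_dom c);
  chartK : forall c p, chart_dom c p -> chart_inv c (chart c p) = p;
  continuous_chart : forall c, {within chart_dom c, continuous (chart c)};
  continuous_param : forall c,
    {within chart c @` chart_dom c, continuous (chart_inv c)};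
  smooth_transition : forall c c' (i : 'I_n),
    smooth_on (chart c @` (chart_dom c `&` chart_dom c'))
      (fun x => chart c' (chart_inv c x) 0 i)
}.

Definition chart_image (R : realType) (n : nat) (M : smooth_manifold R n)
    (c : chart_index M) : set 'rV[R]_n := chart c @` chart_dom c.

Definition transition (R : realType) (n : nat) (M : smooth_manifold R n)
    (c c' : chart_index M) (x : 'rV[R]_n) : 'rV[R]_n :=
  chart c' (chart_inv c x).

(* Totally symmetric smooth covariant tensor field of order [m], given by its
   components in the charts together with their transformation law. *)
Record symmetric_tensor (R : realType) (n : nat) (M : smooth_manifold R n)
    (m : nat) := SymmetricTensor {
  tcomp :> chart_index M -> 'rV[R]_n -> m.-tuple 'I_n -> R;
  smooth_comp : forall c I, smooth_on (chart_image c) (fun x => tcomp c x I);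
  symmetric_comp : forall c x (I J : m.-tuple 'I_n),
    chart_image c x -> perm_eq I J -> tcomp c x I = tcomp c x J;
  comp_transition : forall c c' x (I : m.-tuple 'I_n),
    (chart c @` (chart_dom c `&` chart_dom c')) x ->
    tcomp c x I =
      \sum_(J : m.-tuple 'I_n) tcomp c' (transition c c' x) J *
        \prod_(s < m) 'D_(basis_vec R (tnth I s))
                        (fun x' => transition c c' x' 0 (tnth J s)) x
}.

(* Functions of the coordinates (x, y) of a chart of TM. *)
Definition coord_fun (R : realType) (n : nat) := 'rV[R]_n -> 'rV[R]_n -> R.

Definition dx (R : realType) (n : nat) (i : 'I_n) (f : coord_fun R n) :
    coord_fun R n :=
  fun x y => 'D_(basis_vec R i) (fun x' => f x' y) x.

Definition dy (R : realType) (n : nat) (i : 'I_n) (f : coord_fun R n) :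
    coord_fun R n :=
  fun x y => 'D_(basis_vec R i) (f x) y.

(* In a fixed chart with tensor components [a]. The order of the root is
   written m.+2, which ranges over all integers at least 2. *)
Section LocalGeometry.
Context (R : realType) (n m : nat).
Implicit Type a : 'rV[R]_n -> m.+2.-tuple 'I_n -> R.

Definition mform a : coord_fun R n := fun x y =>
  \sum_(I : m.+2.-tuple 'I_n) a x I * \prod_(i <- I) y 0 i.

(* For an odd order this is the real root of any real number; for an even
   order the root is only defined where [mform] is nonnegative, see
   [root_defined]. *)
Definition root_metric a : coord_fun R n := fun x y =>
  Num.sg (mform a x y) * (`|mform a x y| `^ (m.+2%:R)^-1).

Definition root_defined a (x y : 'rV[R]_n) : Prop :=
  odd m.+2 \/ 0 <= mform a x y.

(* The points of TM minus the zero section near which F is defined and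
   smooth. *)
Definition regular_point a (x y : 'rV[R]_n) : Prop :=
  y <> 0 /\
  \forall z \near (x, y),
    root_defined a z.1 z.2 /\
    smooth_at (fun w : 'rV[R]_n * 'rV[R]_n => root_metric a w.1 w.2) z.

Definition sqF a : coord_fun R n := fun x y => root_metric a x y ^+ 2.

Definition fundamental a (i j : 'I_n) : coord_fun R n := fun x y =>
  2^-1 * dy i (dy j (sqF a)) x y.

Definition fundamental_mx a (x y : 'rV[R]_n) : 'M[R]_n :=
  \matrix_(i, j) fundamental a i j x y.

Definition flag_metric a (i j : 'I_n) : coord_fun R n := fun x y =>
  \sum_(I : m.-tuple 'I_n) a x [tuple of i :: j :: I] * \prod_(s <- I) y 0 s.

Definition flag_mx a (x y : 'rV[R]_n) : 'M[R]_n :=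
  \matrix_(i, j) flag_metric a i j x y.

(* G^i = 1/4 g^{ij} (d^2 F^2 / dy^j dx^k * y^k - d F^2 / dx^j): the
   Euler-Lagrange equations of F^2 are then x'' + 2 G(x, x') = 0. *)
Definition spray a (i : 'I_n) : coord_fun R n := fun x y =>
  4^-1 * \sum_(j < n) invmx (fundamental_mx a x y) i j *
    ((\sum_(k < n) dy j (dx k (sqF a)) x y * y 0 k) - dx j (sqF a) x y).

(* N^i_j *)
Definition nonlinear a (i j : 'I_n) : coord_fun R n := dy j (spray a i).

(* f_{;l} *)
Definition hderiv a (l : 'I_n) (f : coord_fun R n) : coord_fun R n :=
  fun x y => dx l f x y - \sum_(r < n) nonlinear a r l x y * dy r f x y.

(* L^i_{jk} *)
Definition metrical a (i j k : 'I_n) : coord_fun R n := fun x y =>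
  2^-1 * \sum_(s < n) invmx (flag_mx a x y) i s *
    (hderiv a k (flag_metric a s j) x y + hderiv a j (flag_metric a s k) x y
     - hderiv a s (flag_metric a j k) x y).

(* t_{ijk|l} *)
Definition hcov a (t : 'I_n -> 'I_n -> 'I_n -> coord_fun R n)
    (i j k l : 'I_n) : coord_fun R n := fun x y =>
  hderiv a l (t i j k) x y
  - (\sum_(r < n) metrical a r i l x y * t r j k x y)
  - (\sum_(r < n) metrical a r j l x y * t i r k x y)
  - (\sum_(r < n) metrical a r k l x y * t i j r x y).

(* h_{ij.k} *)
Definition dflag a (i j k : 'I_n) : coord_fun R n := dy k (flag_metric a i j).

(* G^i_{jk} *)
Definition berwald a (i j k : 'I_n) : coord_fun R n :=
  dy j (dy k (spray a i)).

End LocalGeometry.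

Section RootMetricSpace.
Context (R : realType) (n m : nat) (M : smooth_manifold R n).
Implicit Type a : symmetric_tensor M m.+2.

(* (x, y) are coordinates, in the chart c, of a point of TM minus the zero
   section near which F is defined and smooth. *)
Definition regular_in a (c : chart_index M) (x y : 'rV[R]_n) : Prop :=
  chart_image c x /\ regular_point (a c) x y.

Definition is_root_metric_space a : Prop :=
  forall c x y, regular_in a c x y -> fundamental_mx (a c) x y \in unitmx.

Definition is_berwald_space a : Prop :=
  forall c x y y', regular_in a c x y -> regular_in a c x y' ->
    forall i j k, berwald (a c) i j k x y = berwald (a c) i j k x y'.

Definition is_landsberg_space a : Prop :=
  forall c x y, regular_in a c x y -> forall i j k,
    hderiv (a c) k (fundamental (a c) i j) x y
    - (\sum_(r < n) berwald (a c) r i k x y * fundamental (a c) r j x y)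
    - (\sum_(r < n) berwald (a c) r j k x y * fundamental (a c) i r x y) = 0.

End RootMetricSpace.

(* Main.v *)
Require Import Defs.
From HB Require Import structures.
From mathcomp Require Import all_boot all_order all_algebra.
From mathcomp Require Import all_classical all_reals all_analysis.
From mathcomp Require Import ring lra.
Import Order.TTheory GRing.Theory Num.Theory.
Import numFieldNormedType.Exports.
Local Open Scope ring_scope.

(** Over a fixed base point let P(y) be the m-th root form, scaled so that its
    Hessian is h. Where F is smooth and g is nondegenerate P does not vanish,
    and F^2 is a power of |P|; since F is constant along geodesics, the
    Euler-Lagrange equations of F^2 reduce to
    [2 h_jr G^r = y^k d_(y^j) d_(x^k) P - d_(x^j) P],
    so G is a rational function of y. Contracting with y and differentiating
    gives [P_(;l) = 0], and then, by three successive y-derivatives, formulas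
    for the horizontal derivatives of h_ij and h_ij.k in terms of G^r_jk and
    G^r_ijk. With [e_ijk = P_r G^r_ijk] they read: the Landsberg tensor is
    [(F^2 / P) e_ijk] up to a constant; [L^i_jk = G^i_jk + h^(is) e_sjk / 2];
    [h_ij.k|l y^l = - e_ijk]; and if e = 0 then
    [h_ij.k|l = h_ir G^r_kjl + h_jr G^r_kil]. The last expression vanishes
    only if G^r_ijk does, by symmetry in the three lower indices. *)

(** * Rational functions and their partial derivatives *)

(** Rationality of G in y does double duty. It gives derivatives of every order that commute, by
    induction on the expression. It also settles a global point: the Berwald condition compares
    [G^i_jk] at any two regular vectors over x, and these vectors may form a disconnected set, such
    as the two cones where [y_1^2 - y_2^2 > 0], whereas the vanishing of [G^r_ijk] is local
    information. On the line through two vectors a rational function is a quotient of polynomials in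
    one variable, and this carries constancy from one component to another. Derivatives in x and in
    y are exchanged only for P, where the exchange is a statement about the coefficients of a form.
    The scaling of P comes from the factors m and m - 1 that two differentiations of a form of
    degree m bring down. The converse for Berwald spaces passes through the Landsberg tensor: if
    [h_ij.k|l] vanishes then so does its contraction with y, hence e = 0 on the whole fibre, and
    only then is the last formula for [h_ij.k|l] available. *)

HB.lock Definition partial (R : realType) (n : nat) (i : 'I_n)
    (f : 'rV[R]_n -> R) : 'rV[R]_n -> R :=
  fun y => 'D_(basis_vec R i) f y.
Canonical partial_unlockable := Unlockable partial.unlock.
Arguments partial {R n} i f _.

HB.lock Definition partially_derivable (R : realType) (n : nat)
    (f : 'rV[R]_n -> R) (y : 'rV[R]_n) : Prop :=
  forall i, derivable f y (basis_vec R i).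
Canonical partially_derivable_unlockable :=
  Unlockable partially_derivable.unlock.
Arguments partially_derivable {R n} f y.

Section PartialDerivatives.
Context {R : realType} {n : nat}.
Local Notation V := 'rV[R]_n.
Implicit Types (f g : V -> R) (i j k : 'I_n).

Lemma partialE i f y : partial i f y = 'D_(basis_vec R i) f y.
Proof. by rewrite unlock. Qed.

Lemma partially_derivableP f y :
  partially_derivable f y <-> forall i, derivable f y (basis_vec R i).
Proof. by rewrite unlock. Qed.

Lemma differentiable_partially f y :
  differentiable f y -> partially_derivable f y.
Proof.
by move=> df; apply/partially_derivableP => i; exact: diff_derivable.
Qed.

Lemma partially_derivable_cst (c : R) (y : V) : partially_derivable (fun=> c) y.
Proof. by apply: differentiable_partially; exact: differentiable_cst. Qed.

Lemma partial_cst i (c : R) y : partial i (fun=> c) y = 0.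
Proof. by rewrite partialE; exact: derive_cst. Qed.

Lemma partialD i f g y : partially_derivable f y -> partially_derivable g y ->
  partial i (fun z => f z + g z) y = partial i f y + partial i g y.
Proof.
move=> /partially_derivableP df /partially_derivableP dg.
by rewrite !partialE; exact: (deriveD (df i) (dg i)).
Qed.

Lemma partialM i f g y : partially_derivable f y -> partially_derivable g y ->
  partial i (fun z => f z * g z) y = partial i f y * g y + f y * partial i g y.
Proof.
move=> /partially_derivableP df /partially_derivableP dg.
rewrite !partialE (deriveM (df i) (dg i)).
by rewrite /GRing.scale/= addrC mulrC.
Qed.

Lemma partialV i f y : f y != 0 -> partially_derivable f y ->
  partial i (fun z => (f z)^-1) y = - (partial i f y / (f y) ^+ 2).
Proof.
move=> f0 /partially_derivableP df; rewrite !partialE (deriveV f0 (df i)).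
by rewrite /GRing.scale/= mulNr mulrC.
Qed.

Lemma coord_delta i j : (basis_vec R j) 0 i = (i == j)%:R.
Proof. by rewrite /basis_vec mxE eqxx. Qed.

Lemma differentiable_coordinate i (y : V) :
  differentiable (fun z : V => z 0 i) y.
Proof. exact: differentiable_coord. Qed.

Lemma partial_coord i j (y : V) : partial j (fun z => z 0 i) y = (i == j)%:R.
Proof.
rewrite !partialE deriveE; last exact: differentiable_coord.
have lc : linear (fun z : V => z 0 i : R) by move=> a u v; rewrite !mxE.
pose l := HB.pack (fun z : V => z 0 i : R) (GRing.isLinear.Build _ _ _ _ _ lc)
  : {linear V -> R}.
rewrite (@diff_lin _ _ _ l y); last exact: coord_continuous.
exact: coord_delta.
Qed.

Lemma partially_derivableD f g y : partially_derivable f y ->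
  partially_derivable g y -> partially_derivable (fun z => f z + g z) y.
Proof.
move=> /partially_derivableP df /partially_derivableP dg.
by apply/partially_derivableP => i; exact: (derivableD (df i) (dg i)).
Qed.

Lemma partially_derivableM f g y : partially_derivable f y ->
  partially_derivable g y -> partially_derivable (fun z => f z * g z) y.
Proof.
move=> /partially_derivableP df /partially_derivableP dg.
by apply/partially_derivableP => i; exact: (derivableM (df i) (dg i)).
Qed.

Lemma partially_derivableV f y : f y != 0 -> partially_derivable f y ->
  partially_derivable (fun z => (f z)^-1) y.
Proof.
move=> f0 /partially_derivableP df.
by apply/partially_derivableP => i; exact: (derivableV f0 (df i)).
Qed.

Lemma partialZ i (c : R) f y : partially_derivable f y ->
  partial i (fun z => c * f z) y = c * partial i f y.
Proof.
move=> df; rewrite partialM//; last exact: partially_derivable_cst.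
by rewrite partial_cst mul0r add0r.
Qed.

Lemma partially_derivableZ (c : R) f y : partially_derivable f y ->
  partially_derivable (fun z => c * f z) y.
Proof.
by move=> df; apply: partially_derivableM => //; exact: partially_derivable_cst.
Qed.

Lemma near_eq_partially_derivable f g y : (\near y, f y = g y) ->
  partially_derivable f y -> partially_derivable g y.
Proof.
move=> fg /partially_derivableP df; apply/partially_derivableP => i.
(* The transfer lemma [near_eq_derivable] asks for a nonzero direction. *)
have [e0|/eqP e0] := eqVneq (basis_vec R i) 0.
  by rewrite e0; exact: derivable0.
have e0' : basis_vec R i != 0 by apply/eqP.
exact: near_eq_derivable fg (df i).
Qed.

Lemma eq_partial i f g y : f =1 g -> partial i f y = partial i g y.
Proof. by move=> /funext->. Qed.

Lemma near_eq_partial i f g y :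
  (\near y, f y = g y) -> partial i f y = partial i g y.
Proof. by rewrite !partialE; exact: near_eq_derive. Qed.

End PartialDerivatives.

(** * Rational expressions on a set and their differential calculus *)

Section RationalFunctions.
Context {R : realType} {n : nat} (U : set 'rV[R]_n).
Local Notation V := 'rV[R]_n.
Implicit Types (f g : V -> R).

(** Stated through expressions rather than as a quotient of two polynomials, so that differentiation
    is an induction. [rational_ext] leaves a function arbitrary outside [U], as happens with [invmx]
    where the matrix degenerates. *)
Inductive rational_on : (V -> R) -> Prop :=
| rational_cst c : rational_on (fun=> c)
| rational_coord i : rational_on (fun y => y 0 i)
| rationalD f g : rational_on f -> rational_on g ->
    rational_on (fun y => f y + g y)
| rationalM f g : rational_on f -> rational_on g ->
    rational_on (fun y => f y * g y)
| rationalV f : rational_on f -> (forall y, U y -> f y != 0) ->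
    rational_on (fun y => (f y)^-1)
| rational_ext f g : rational_on f -> (forall y, U y -> f y = g y) ->
    rational_on g.

Lemma rationalN f : rational_on f -> rational_on (fun y => - f y).
Proof.
move=> rf; apply: (rational_ext (fun y => -1 * f y)).
  by apply: rationalM => //; exact: rational_cst.
by move=> y _; rewrite mulN1r.
Qed.

Lemma rationalB f g : rational_on f -> rational_on g ->
  rational_on (fun y => f y - g y).
Proof. by move=> rf rg; apply: rationalD => //; exact: rationalN. Qed.

Lemma rational_sum (I : Type) (s : seq I) (Q : pred I) (F : I -> V -> R) :
  (forall i, Q i -> rational_on (F i)) ->
  rational_on (fun y => \sum_(i <- s | Q i) F i y).
Proof.
move=> rF; elim: s => [|i s IH].
  apply: (rational_ext (fun=> 0)); first exact: rational_cst.
  by move=> y _; rewrite big_nil.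
have [Qi|Qi] := boolP (Q i).
  apply: (rational_ext _ _ (rationalD _ _ (rF i Qi) IH)) => y _.
  by rewrite big_cons Qi.
apply: (rational_ext _ _ IH) => y _.
by rewrite big_cons (negbTE Qi).
Qed.

Lemma rational_prod (I : Type) (s : seq I) (Q : pred I) (F : I -> V -> R) :
  (forall i, Q i -> rational_on (F i)) ->
  rational_on (fun y => \prod_(i <- s | Q i) F i y).
Proof.
move=> rF; elim: s => [|i s IH].
  apply: (rational_ext (fun=> 1)); first exact: rational_cst.
  by move=> y _; rewrite big_nil.
have [Qi|Qi] := boolP (Q i).
  apply: (rational_ext _ _ (rationalM _ _ (rF i Qi) IH)) => y _.
  by rewrite big_cons Qi.
apply: (rational_ext _ _ IH) => y _.
by rewrite big_cons (negbTE Qi).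
Qed.

Lemma rational_det k (A : V -> 'M[R]_k) :
  (forall i j, rational_on (fun y => A y i j)) ->
  rational_on (fun y => \det (A y)).
Proof.
move=> rA; apply: rational_sum => s _.
by apply: rationalM; [exact: rational_cst|apply: rational_prod => i _].
Qed.

Lemma rational_invmx k (A : V -> 'M[R]_k) :
  (forall i j, rational_on (fun y => A y i j)) ->
  (forall y, U y -> A y \in unitmx) ->
  forall i j, rational_on (fun y => invmx (A y) i j).
Proof.
move=> rA uA i j.
(* Cramer's rule: the entries of the adjugate are signed minors. *)
apply: (rational_ext (fun y => (\det (A y))^-1 *
    ((-1) ^+ (j + i) * \det (row' j (col' i (A y)))))).
  apply: rationalM.
    apply: rationalV; first exact: rational_det.
    by move=> y /uA; rewrite unitmxE unitfE.
  apply: rationalM; first exact: rational_cst.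
  apply: rational_det => p q.
  by apply: (rational_ext _ _ (rA (lift j p) (lift i q))) => y _; rewrite !mxE.
by move=> y /uA uy; rewrite /invmx uy !mxE.
Qed.

(** One pair [p], [q] serves the whole line, so the formula persists across the gaps where the line
    leaves [U]. *)
Lemma rational_line f (y v : V) : rational_on f ->
  exists p q : {poly R}, forall t, U (y + t *: v) ->
    q.[t] != 0 /\ f (y + t *: v) = p.[t] / q.[t].
Proof.
elim=> {f}
  [c|i|f g _ [p [q Hf]] _ [p' [q' Hg]]|f g _ [p [q Hf]] _ [p' [q' Hg]]
  |f _ [p [q Hf]] f0|f g _ [p [q Hf]] fg].
- by exists c%:P, 1 => t _; rewrite !hornerE oner_eq0 divr1.
- exists ((y 0 i)%:P + (v 0 i) *: 'X), 1 => t _.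
  by rewrite !hornerE oner_eq0 divr1 !mxE mulrC.
- exists (p * q' + p' * q), (q * q') => t Ut.
  have [q0 ->] := Hf _ Ut; have [q0' ->] := Hg _ Ut.
  by rewrite !hornerE mulf_neq0//; split => //; field; rewrite q0 q0'.
- exists (p * p'), (q * q') => t Ut.
  have [q0 ->] := Hf _ Ut; have [q0' ->] := Hg _ Ut.
  by rewrite !hornerM mulf_neq0//; split => //; field; rewrite q0 q0'.
- exists q, p => t Ut; have [q0 E] := Hf _ Ut.
  have := f0 _ Ut; rewrite E => pq0; rewrite invf_div; split => //.
  by apply: contraNneq pq0 => ->; rewrite mul0r.
- by exists p, q => t Ut; rewrite -fg//; exact: Hf.
Qed.

Hypothesis oU : open U.

Lemma near_on (Q : V -> Prop) y : (forall z, U z -> Q z) -> U y -> \near y, Q y.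
Proof.
move=> UQ Uy; have := open_nbhs_nbhs (conj oU Uy).
by apply: filterS => z; exact: UQ.
Qed.

Lemma eq_on_partial f g y (i : 'I_n) : (forall z, U z -> f z = g z) -> U y ->
  partial i f y = partial i g y.
Proof. by move=> fg Uy; apply: near_eq_partial; exact: near_on fg Uy. Qed.

Lemma rational_derivable f y :
  rational_on f -> U y -> partially_derivable f y.
Proof.
move=> rf Uy; elim: rf => {f}
  [c|i|f g _ df _ dg|f g _ df _ dg|f _ df f0|f g _ df fg].
- exact: partially_derivable_cst.
- by apply: differentiable_partially; exact: differentiable_coordinate.
- exact: partially_derivableD.
- exact: partially_derivableM.
- by apply: partially_derivableV => //; exact: f0.
- by apply: near_eq_partially_derivable df; exact: near_on fg Uy.
Qed.

Lemma partial_sum (i : 'I_n) (I : Type) (s : seq I) (F : I -> V -> R) y :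
  (forall k, rational_on (F k)) -> U y ->
  partial i (fun z => \sum_(k <- s) F k z) y = \sum_(k <- s) partial i (F k) y.
Proof.
move=> rF Uy; elim: s => [|k s IH].
  rewrite big_nil -[RHS](partial_cst i 0 y).
  by apply: eq_partial => z; rewrite big_nil.
rewrite big_cons -IH -partialD.
- by apply: eq_partial => z; rewrite big_cons.
- exact: rational_derivable.
- by apply: rational_derivable => //; exact: rational_sum.
Qed.

Lemma rational_partial f (i : 'I_n) :
  rational_on f -> rational_on (partial i f).
Proof.
elim=> {f} [c|j|f g rf df rg dg|f g rf df rg dg|f rf df f0|f g rf df fg].
- apply: (rational_ext _ _ (rational_cst 0)) => y _.
  by rewrite partial_cst.
- apply: (rational_ext _ _ (rational_cst (j == i)%:R)) => y _.
  by rewrite partial_coord.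
- apply: (rational_ext _ _ (rationalD _ _ df dg)) => y Uy.
  by rewrite partialD//; exact: rational_derivable.
- apply: (rational_ext _ _
    (rationalD _ _ (rationalM _ _ df rg) (rationalM _ _ rf dg))) => y Uy.
  by rewrite partialM//; exact: rational_derivable.
- apply: (rational_ext (fun y => - (partial i f y * ((f y)^-1 * (f y)^-1)))).
    by apply: rationalN; apply: rationalM => //; apply: rationalM;
      exact: rationalV.
  move=> y Uy; rewrite partialV ?f0//; last exact: rational_derivable.
  by rewrite expr2 invfM.
- apply: (rational_ext _ _ df) => y Uy.
  exact: eq_on_partial.
Qed.

(** By induction on the expression: the rules for sums, products and inverses give formulas
    symmetric in [i] and [j] once the induction hypotheses are applied. *)
Lemma partialC f (i j : 'I_n) y : rational_on f -> U y ->
  partial i (partial j f) y = partial j (partial i f) y.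
Proof.
move=> rf; elim: rf y => {f}
  [c|k|f g rf df rg dg|f g rf df rg dg|f rf df f0|f g rf df fg] y Uy.
- rewrite !(eq_on_partial (partial _ _) (fun=> 0) y) ?partial_cst//.
  + by move=> z _; exact: partial_cst.
  + by move=> z _; exact: partial_cst.
- rewrite (eq_on_partial (partial j _) (fun=> (k == j)%:R) y) ?partial_cst//.
    rewrite (eq_on_partial (partial i _) (fun=> (k == i)%:R) y) ?partial_cst//.
    by move=> z _; exact: partial_coord.
  by move=> z _; exact: partial_coord.
- have E l z : U z -> partial l (fun z => f z + g z) z =
      partial l f z + partial l g z.
    by move=> Uz; rewrite partialD//; exact: rational_derivable.
  rewrite [LHS](eq_on_partial _
    (fun z => partial j f z + partial j g z))//; last exact: E.
  rewrite [RHS](eq_on_partial _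
    (fun z => partial i f z + partial i g z))//; last exact: E.
  by rewrite !partialD ?df ?dg//; apply: rational_derivable => //;
    exact: rational_partial.
- have E l z : U z -> partial l (fun z => f z * g z) z =
      partial l f z * g z + f z * partial l g z.
    by move=> Uz; rewrite partialM//; exact: rational_derivable.
  rewrite [LHS](eq_on_partial _
    (fun z => partial j f z * g z + f z * partial j g z))//; last exact: E.
  rewrite [RHS](eq_on_partial _
    (fun z => partial i f z * g z + f z * partial i g z))//; last exact: E.
  have D h : rational_on h -> partially_derivable h y.
    by move=> rh; exact: rational_derivable.
  have rp := rational_partial.
  rewrite !partialD ?partialM ?df ?dg//; [by ring|..]; apply: D;
    repeat first [assumption|apply: rp|apply: rationalM].
- have E l z : U z -> partial l (fun z => (f z)^-1) z =
      - (partial l f z * ((f z)^-1 * (f z)^-1)).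
    move=> Uz; rewrite partialV ?f0//; last exact: rational_derivable.
    by rewrite expr2 invfM.
  rewrite [LHS](eq_on_partial _
    (fun z => - (partial j f z * ((f z)^-1 * (f z)^-1))))//; last exact: E.
  rewrite [RHS](eq_on_partial _
    (fun z => - (partial i f z * ((f z)^-1 * (f z)^-1))))//; last exact: E.
  have D h : rational_on h -> partially_derivable h y.
    by move=> rh; exact: rational_derivable.
  have rp := rational_partial.
  have rV : rational_on (fun z => (f z)^-1) by exact: rationalV.
  have PN l h : rational_on h -> partial l (fun z => - h z) y = - partial l h y.
    move=> rh; rewrite -mulN1r -[RHS]add0r -[X in X + _](mul0r (h y)).
    rewrite -(partial_cst l (-1) y) -partialM; last exact: D.
      by apply: eq_partial => z; rewrite mulN1r.
    by apply: D; exact: rational_cst.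
  rewrite !PN ?partialM ?E ?df//; [by ring|..]; try apply: D;
    repeat first [assumption|apply: rp|apply: rationalM].
- rewrite -(eq_on_partial (partial i f) (partial i g))//; last first.
    by move=> z Uz; exact: eq_on_partial.
  rewrite -(eq_on_partial (partial j f) (partial j g)) ?df//.
  by move=> z Uz; exact: eq_on_partial.
Qed.

End RationalFunctions.

(** * Rational functions with vanishing partial derivatives *)

Section LocallyConstantRational.
Context {R : realType} {n : nat} (U : set 'rV[R]_n) (oU : open U).
Local Notation V := 'rV[R]_n.

(** In general partial derivatives do not control the other directions; for rational expressions an
    induction shows that they do. This allows differentiation along an arbitrary line. *)
Lemma rational_is_derive (f : V -> R) (y v : V) : rational_on U f -> U y ->
  is_derive y v f (\sum_i v 0 i * partial i f y).
Proof.
move=> rf Uy; elim: rf => {f}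
  [c|i|f g rf df rg dg|f g rf df rg dg|f rf df f0|f g rf df fg].
- have H : is_derive y v (fun=> c) 0 := is_derive_cst c y v.
  by apply: (is_derive_eq H); rewrite big1// => i _; rewrite partial_cst mulr0.
- have d : differentiable (fun z : V => z 0 i) y.
    exact: differentiable_coordinate.
  have H : is_derive y v (fun z : V => z 0 i) ('D_v (fun z : V => z 0 i) y).
    by apply: derivableP; exact: diff_derivable.
  apply: (is_derive_eq H); rewrite deriveE//.
  transitivity ('d (fun z : V => z 0 i) y (\sum_j v 0 j *: basis_vec R j)).
    by congr ('d _ _ _); rewrite [LHS]row_sum_delta.
  rewrite linear_sum; apply: eq_bigr => j _.
  by rewrite partialE deriveE//; exact: linearZ.
- apply: (is_derive_eq (is_deriveD df dg)); rewrite -big_split.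
  apply: eq_bigr => i _ /=; rewrite partialD ?mulrDr//;
    exact: (rational_derivable U).
- apply: (is_derive_eq (is_deriveM df dg)).
  rewrite /GRing.scale/= !mulr_sumr -big_split; apply: eq_bigr => i _ /=.
  rewrite partialM; first by ring.
    exact: (rational_derivable U).
  exact: (rational_derivable U).
- have fy := f0 _ Uy; have [d E] := df.
  have H : is_derive y v (fun z => (f z)^-1) (- (f y) ^- 2 *: 'D_v f y).
    by apply: DeriveDef; [exact: derivableV|exact: deriveV].
  apply: (is_derive_eq H); rewrite E /GRing.scale/= mulr_sumr.
  apply: eq_bigr => i _; rewrite partialV//; last exact: (rational_derivable U).
  by field.
- have N : \near y, f y = g y by exact: near_on oU _ _ fg Uy.
  apply: (is_derive_eq (near_eq_is_derive N df)).
  by apply: eq_bigr => i _; rewrite (eq_on_partial U oU f g).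
Qed.

Lemma poly_eq0_near0 (p : {poly R}) (d : R) : 0 < d ->
  (forall t, 0 < t < d -> root p t) -> p = 0.
Proof.
(* The points [d / (k + 2)] are distinct, lie strictly between 0 and [d], and number [size p], more
   than a nonzero [p] has roots. *)
move=> d0 rp; pose rs := [seq d / k.+2%:R | k <- iota 0 (size p)].
apply: (@roots_geq_poly_eq0 _ p rs).
- apply/allP => t /mapP[k _ ->]; apply: rp; rewrite divr_gt0//=.
  by rewrite ltr_pdivrMr// ltr_pMr// ltr1n.
- rewrite map_inj_uniq ?iota_uniq// => k l /(mulfI (lt0r_neq0 d0)) /invr_inj.
  by move=> /eqP; rewrite eqr_nat => /eqP[].
- by rewrite size_map size_iota.
Qed.

(* On a line through [y], the function is a quotient of polynomials that is
   constant near [y], hence constant, also outside the connected component of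
   [y] in [U]. *)
Lemma rational_constant (f : V -> R) (y y' : V) : rational_on U f ->
  (forall z, U z -> forall i, partial i f z = 0) -> U y -> U y' -> f y = f y'.
Proof.
move=> rf df0 Uy Uy'; pose v := y' - y; pose l (t : R) := t *: v + y.
have [p [q pqE]] := rational_line U f y v rf.
have lE t : l t = y + t *: v by rewrite /l addrC.
have l0 : l 0 = y by rewrite /l scale0r add0r.
have l1 : l 1 = y' by rewrite /l scale1r subrK.
have dl t : U (l t) -> is_derive t (1 : R) (f \o l) 0.
  move=> Ul; have [d E] := rational_is_derive f (l t) v rf Ul.
  have E0 : 'D_v f (l t) = 0.
    by rewrite E big1// => i _; rewrite df0// mulr0.
  have growthE : (fun h : R => h^-1 *: ((f \o l) (h *: 1 + t) - (f \o l) t)) =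
      (fun h : R => h^-1 *: (f (h *: v + l t) - f (l t))).
    by apply: funext => h; rewrite /l/= [h *: 1]mulr1 scalerDl addrA.
  by apply: DeriveDef; [rewrite /derivable growthE|rewrite /derive growthE].
have [d d0 dU] : exists2 d : R, 0 < d & forall t, `|t| < d -> U (l t).
  have cl : {for 0, continuous l}.
    by apply: differentiable_continuous; apply: differentiableD.
  have : nbhs (0 : R) (l @^-1` U)%classic.
    by apply: cl; rewrite l0; exact: open_nbhs_nbhs.
  move=> /nbhs_ballP[d d0 dU]; exists d => // t td.
  by apply: dU; rewrite /ball/= sub0r normrN.
have cst t : 0 < t < d -> f (l t) = f y.
  move=> /andP[t0 td].
  have dUt s : s \in `[0, t] -> U (l s).
    rewrite in_itv/= => /andP[s0 st]; apply: dU.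
    by rewrite ger0_norm// (le_lt_trans st).
  have fl s : s \in `[0, t] -> is_derive s (1 : R) (f \o l) 0.
    by move=> /dUt; exact: dl.
  have cfl : ({within `[0%R, t], continuous (f \o l)})%classic.
    by apply: derivable_within_continuous => s /fl[].
  have flo s : s \in `]0, t[ -> is_derive s (1 : R) (f \o l) ((fun=> 0) s).
    by move=> /subset_itv_oo_cc; exact: fl.
  have [c _] := @MVT R (f \o l) (fun=> 0) 0 t t0 flo cfl.
  rewrite mul0r => /eqP; rewrite subr_eq0 => /eqP.
  by rewrite -l0.
have [q0 fy] : q.[0] != 0 /\ f y = p.[0] / q.[0].
  by have := pqE 0; rewrite -lE l0; exact.
have [q1 fy'] : q.[1] != 0 /\ f y' = p.[1] / q.[1].
  by have := pqE 1; rewrite -lE l1; exact.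
have pq : p - f y *: q = 0.
  apply: (poly_eq0_near0 _ d d0) => t t0d.
  have td : `|t| < d by case/andP: t0d => t0 td; rewrite gtr0_norm.
  have := dU t td; rewrite lE => /pqE[qt]; rewrite -lE cst// => ->.
  by rewrite /root !hornerE divfK// subrr.
rewrite fy'; have /eqP := pq; rewrite subr_eq0 => /eqP ->.
by rewrite hornerZ mulfK.
Qed.

End LocallyConstantRational.

Ltac rational :=
  repeat first [ assumption | exact: rational_coord | exact: rational_cst
               | apply: rational_partial | apply: rationalM
               | apply: rationalB | apply: rationalD
               | apply: rational_sum => ? _ ].

(** * Sprays of homogeneous forms *)

Section EulerHomogeneity.
Context {R : realType} {n : nat} (U : set 'rV[R]_n) (oU : open U).
Local Notation V := 'rV[R]_n.
Implicit Types (f g : V -> R).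

Lemma partial_sumM (i : 'I_n) (f g : 'I_n -> V -> R) y :
  (forall k, rational_on U (f k)) -> (forall k, rational_on U (g k)) -> U y ->
  partial i (fun z => \sum_k f k z * g k z) y =
  \sum_k (partial i (f k) y * g k y + f k y * partial i (g k) y).
Proof.
move=> rf rg Uy; rewrite (partial_sum U)//; last by move=> k; rational.
by apply: eq_bigr => k _; rewrite partialM//; exact: (rational_derivable U).
Qed.

Lemma rational_partialD (i : 'I_n) f g y :
  rational_on U f -> rational_on U g -> U y ->
  partial i (fun z => f z + g z) y = partial i f y + partial i g y.
Proof. by move=> *; apply: partialD; exact: (rational_derivable U). Qed.

Lemma rational_partialM (i : 'I_n) f g y :
  rational_on U f -> rational_on U g -> U y ->
  partial i (fun z => f z * g z) y = partial i f y * g y + f y * partial i g y.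
Proof. by move=> *; apply: partialM; exact: (rational_derivable U). Qed.

Lemma rational_partialB (i : 'I_n) f g y :
  rational_on U f -> rational_on U g -> U y ->
  partial i (fun z => f z - g z) y = partial i f y - partial i g y.
Proof.
move=> rf rg Uy; have rc : rational_on U (fun=> -1) by rational.
rewrite (eq_partial i _ (fun z => f z + (-1) * g z)); last first.
  by move=> z; rewrite mulN1r.
rewrite rational_partialD ?rational_partialM ?partial_cst//; last by rational.
by rewrite mul0r add0r mulN1r.
Qed.

Definition euler f (y : V) : R := \sum_k y 0 k * partial k f y.

(** Euler's identity is the definition, which makes sense on any [U]; the degree is real so that 1
    can be subtracted repeatedly. *)
Definition homogeneous (d : R) f : Prop :=
  forall y, U y -> euler f y = d * f y.

Lemma eulerM f g y : rational_on U f -> rational_on U g -> U y ->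
  euler (fun z => f z * g z) y = euler f y * g y + f y * euler g y.
Proof.
move=> rf rg Uy; rewrite /euler mulr_suml mulr_sumr -big_split/=.
by apply: eq_bigr => k _; rewrite rational_partialM//; ring.
Qed.

Lemma euler_sum (f : 'I_n -> V -> R) y : (forall k, rational_on U (f k)) ->
  U y -> euler (fun z => \sum_k f k z) y = \sum_k euler (f k) y.
Proof.
move=> rf Uy; rewrite /euler exchange_big/=; apply: eq_bigr => k _.
by rewrite (partial_sum U)// mulr_sumr.
Qed.

Lemma eulerB f g y : rational_on U f -> rational_on U g -> U y ->
  euler (fun z => f z - g z) y = euler f y - euler g y.
Proof.
move=> rf rg Uy; rewrite /euler -sumrB.
by apply: eq_bigr => k _; rewrite rational_partialB//; ring.
Qed.

Lemma euler_coord (i : 'I_n) y : euler (fun z : V => z 0 i) y = y 0 i.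
Proof.
rewrite /euler (bigD1 i)//= partial_coord eqxx mulr1 big1 ?addr0// => k ki.
by rewrite partial_coord eq_sym (negbTE ki) mulr0.
Qed.

Lemma eq_euler f g y : (forall z, U z -> f z = g z) -> U y ->
  euler f y = euler g y.
Proof.
move=> fg Uy; apply: eq_bigr => k _.
by rewrite (eq_on_partial U oU f g).
Qed.

Lemma sum_partial_coord (i : 'I_n) (f : 'I_n -> R) y :
  \sum_k partial i (fun z : V => z 0 k) y * f k = f i.
Proof.
rewrite (bigD1 i)//= partial_coord eqxx mul1r big1 ?addr0// => k ki.
by rewrite partial_coord (negbTE ki) mul0r.
Qed.

Lemma partial_contraction (i : 'I_n) (f : 'I_n -> V -> R) y :
  (forall k, rational_on U (f k)) -> U y ->
  partial i (fun z => \sum_k z 0 k * f k z) y =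
  f i y + \sum_k y 0 k * partial i (f k) y.
Proof.
move=> rf Uy; rewrite partial_sumM//; last by move=> k; rational.
by rewrite big_split/= sum_partial_coord.
Qed.

(** Differentiating Euler's identity in [y^i] produces one extra copy of [partial i f], hence the
    drop in degree. *)
Lemma homogeneous_partial d f (i : 'I_n) : rational_on U f ->
  homogeneous d f -> homogeneous (d - 1) (partial i f).
Proof.
move=> rf hf y Uy.
have := eq_on_partial U oU _ _ y i hf Uy.
rewrite partial_contraction//; last by move=> k; rational.
rewrite rational_partialM//; last by rational.
rewrite partial_cst mul0r add0r mulrBl mul1r => <-.
rewrite addrAC subrr add0r; apply: eq_bigr => k _.
by rewrite (partialC U oU f k i).
Qed.

End EulerHomogeneity.

(** * Identities for the spray over a fixed base point *)

Section SprayIdentities.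
Context {R : realType} {n : nat}.
Local Notation V := 'rV[R]_n.

Definition hessian (P : V -> R) (i j : 'I_n) : V -> R :=
  partial i (partial j P).

(* Over a fixed base point, [P] is the fundamental form divided by [p (p - 1)],
   so that its Hessian is the flag metric, [Q l] is the derivative of [P] with
   respect to the [l]-th base coordinate, and [G] is the spray. *)
Record spray_system (U : set V) (p : nat) (P : V -> R) (Q G : 'I_n -> V -> R)
    : Prop := SpraySystem {
  system_degree : (1 < p)%N;
  system_rational : rational_on U P;
  system_rational_base : forall l, rational_on U (Q l);
  system_rational_spray : forall r, rational_on U (G r);
  system_homogeneous : homogeneous U p%:R P;
  system_homogeneous_base : forall l, homogeneous U p%:R (Q l);
  system_hess_inj : forall y (v : 'I_n -> R), U y ->
    (forall j, \sum_r hessian P j r y * v r = 0) -> forall r, v r = 0;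
  system_sprayE : forall y j, U y ->
    2 * (\sum_r hessian P j r y * G r y) =
    \sum_k y 0 k * partial j (Q k) y - Q j y
}.

Context (U : set V) (oU : open U) (p : nat) (P : V -> R) (Q G : 'I_n -> V -> R).
Hypothesis sys : spray_system U p P Q G.

Local Notation hess := (hessian P).
Let p_gt1 := system_degree _ _ _ _ _ sys.
Let rP := system_rational _ _ _ _ _ sys.
Let rQ := system_rational_base _ _ _ _ _ sys.
Let rG := system_rational_spray _ _ _ _ _ sys.
Let homP := system_homogeneous _ _ _ _ _ sys.
Let homQ := system_homogeneous_base _ _ _ _ _ sys.
Let hess_inj := system_hess_inj _ _ _ _ _ sys.
Let sprayE := system_sprayE _ _ _ _ _ sys.

Let rhess i j : rational_on U (hess i j).
Proof. by rewrite /hessian; rational. Qed.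

Lemma hessC i j y : U y -> hess i j y = hess j i y.
Proof. by move=> Uy; rewrite /hessian (partialC U). Qed.

Lemma eq_hess_sum y (v w : 'I_n -> R) : U y ->
  (forall j, \sum_r hess j r y * v r = \sum_r hess j r y * w r) ->
  forall r, v r = w r.
Proof.
move=> Uy vw r; apply/eqP; rewrite -subr_eq0; apply/eqP.
apply: (hess_inj y (fun r => v r - w r)) => // j.
rewrite -[RHS](subrr (\sum_r hess j r y * w r)) -{1}vw -sumrB.
by apply: eq_bigr => k _; rewrite mulrBr.
Qed.

(** Apply the Euler operator to the spray equation: the right side has degree [p] and the Hessian
    degree [p - 2], so the Hessian annihilates [euler (G r) - 2 * G r]. *)
Lemma spray_homogeneous r : homogeneous U 2 (G r).
Proof.
move=> y Uy; move: r.
apply: (eq_hess_sum y (fun r => euler (G r) y) (fun r => 2 * G r y)) => // j /=.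
have homh i : homogeneous U (p%:R - 1 - 1) (hess j i).
  rewrite /hessian; apply: (homogeneous_partial U oU); first by rational.
  exact: (homogeneous_partial U oU).
have E : euler (fun z => \sum_r hess j r z * G r z) y =
    p%:R * \sum_r hess j r y * G r y.
  have rS : rational_on U (fun z => \sum_r hess j r z * G r z).
    by apply: rational_sum => ? _; apply: rationalM.
  have rc c : rational_on U (fun=> c) by rational.
  have rpQ k : rational_on U (fun z => z 0 k * partial j (Q k) z) by rational.
  have r2 : rational_on U (fun z => 2 * \sum_r hess j r z * G r z).
    exact: rationalM.
  have H : euler (fun z => \sum_k z 0 k * partial j (Q k) z) y =
      p%:R * \sum_k y 0 k * partial j (Q k) y.
    rewrite (euler_sum U)// mulr_sumr; apply: eq_bigr => k _.
    rewrite (eulerM U)// ?euler_coord//; try by rational.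
    by rewrite (homogeneous_partial U oU p%:R)//; ring.
  have := eq_euler U oU _ _ y (fun z => sprayE z j) Uy.
  rewrite (eulerM U)// (eulerB U)//; try by rational.
  rewrite H homQ// -mulrBr -sprayE// {1}/euler big1 ?mul0r ?add0r => [|k _].
    by move=> E; apply: (@mulfI _ 2); rewrite // E; ring.
  by rewrite partial_cst mulr0.
rewrite (euler_sum U)// in E; last by move=> k; exact: rationalM.
under [RHS]eq_bigr do rewrite mulrCA.
rewrite -mulr_sumr; apply: (addrI ((p%:R - 2) * \sum_r hess j r y * G r y)).
rewrite -mulrDl subrK -E mulr_sumr -big_split; apply: eq_bigr => k _ /=.
by rewrite (eulerM U)// homh//; ring.
Qed.

(** Contracting the spray equation with [y^j] and using Euler's identity puts a factor [p - 1] on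
    both sides. The result says that [P] is constant along geodesics. *)
Lemma spray_contraction y : U y ->
  2 * (\sum_r partial r P y * G r y) = \sum_k y 0 k * Q k y.
Proof.
move=> Uy.
have p1 : p%:R - 1 != 0 :> R by rewrite subr_eq0 pnatr_eq1 gtn_eqF.
have E : \sum_j y 0 j * (2 * \sum_r hess j r y * G r y) =
    \sum_j y 0 j * (\sum_k y 0 k * partial j (Q k) y - Q j y).
  by apply: eq_bigr => j _; rewrite sprayE.
apply: (mulfI p1); transitivity
  (\sum_j y 0 j * (2 * \sum_r hess j r y * G r y)).
  under [RHS]eq_bigr do rewrite mulrCA mulr_sumr.
  rewrite -mulr_sumr mulrCA exchange_big/=; congr (2 * _).
  rewrite mulr_sumr; apply: eq_bigr => r _.
  have := homogeneous_partial U oU p%:R P r rP homP y Uy.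
  rewrite mulrA => <-; rewrite /euler mulr_suml; apply: eq_bigr => j _.
  by rewrite /hessian; ring.
rewrite E; under eq_bigr do rewrite mulrBr mulr_sumr.
rewrite sumrB exchange_big/= mulrBl mul1r; congr (_ - _).
rewrite mulr_sumr; apply: eq_bigr => k _.
have := homQ k y Uy; rewrite /euler mulrCA => <-; rewrite mulr_sumr.
by apply: eq_bigr => j _; ring.
Qed.

(* That is, [P_(;l) = 0]. *)
Lemma horizontal_constancy y l : U y ->
  Q l y = \sum_r partial r P y * partial l (G r) y.
Proof.
move=> Uy; have rc : rational_on U (fun=> 2) by rational.
have := eq_on_partial U oU _ _ y l spray_contraction Uy.
rewrite (partial_contraction U)// (rational_partialM U)//; last by rational.
rewrite partial_cst mul0r add0r (partial_sumM U)//; last by move=> k; rational.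
(* The [y^l]-derivative of [spray_contraction] contains both sides of the spray equation; removing
   them leaves twice the claim. *)
by rewrite big_split/= mulrDr (sprayE y l)// => E; lra.
Qed.

Lemma horizontal_constancy1 y i l : U y ->
  partial i (Q l) y = \sum_r hess i r y * partial l (G r) y
    + \sum_r partial r P y * partial i (partial l (G r)) y.
Proof.
move=> Uy; have H z : U z -> _ := horizontal_constancy z l.
rewrite (eq_on_partial U oU _ _ y i H)// (partial_sumM U) ?big_split//=;
  by move=> k; rational.
Qed.

(* In index notation, [bcoef], [bcurv] and [landsberg] are [G^r_jk], its
   derivative [G^r_ijk] and [P_r G^r_ijk]. *)
Definition bcoef (r j k : 'I_n) : V -> R := partial j (partial k (G r)).

Definition bcurv (r i j k : 'I_n) : V -> R := partial i (bcoef r j k).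

Definition landsberg (i j k : 'I_n) : V -> R :=
  fun y => \sum_r partial r P y * bcurv r i j k y.

(* The horizontal derivative of [hess i j], the derivative in [x] being the
   vertical Hessian of [Q l]. *)
Definition hess_hderiv (l i j : 'I_n) : V -> R := fun y =>
  partial i (partial j (Q l)) y
  - \sum_r partial l (G r) y * partial r (hess i j) y.

Definition dhess_hderiv (l i j k : 'I_n) : V -> R := fun y =>
  partial k (partial i (partial j (Q l))) y
  - \sum_r partial l (G r) y * partial r (partial k (hess i j)) y.

Let rbcoef r j k : rational_on U (bcoef r j k).
Proof. by rewrite /bcoef; rational. Qed.

Let rbcurv r i j k : rational_on U (bcurv r i j k).
Proof. by rewrite /bcurv; rational. Qed.

Let rlandsberg i j k : rational_on U (landsberg i j k).
Proof. by rewrite /landsberg; rational. Qed.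

Lemma partial_hessC i j k y : U y ->
  partial k (hess i j) y = partial i (hess k j) y.
Proof. by move=> Uy; apply: (partialC U) => //; rational. Qed.

Lemma bcurvC r i j k y : U y -> bcurv r i j k y = bcurv r j i k y.
Proof. by move=> Uy; apply: (partialC U) => //; rational. Qed.

Lemma bcurvCr r i j k y : U y -> bcurv r i j k y = bcurv r i k j y.
Proof.
move=> Uy; apply: (eq_on_partial U) => // z Uz.
exact: (partialC U).
Qed.

(** Two [y]-derivatives of [horizontal_constancy]. The terms with three derivatives of [P] are those
    that [hess_hderiv] subtracts. *)
Lemma hess_hderivE l i j y : U y -> hess_hderiv l i j y =
  \sum_r hess i r y * bcoef r j l y + \sum_r hess j r y * bcoef r i l y
  + landsberg i j l y.
Proof.
move=> Uy; have H z : U z -> _ := horizontal_constancy1 z j l.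
rewrite /hess_hderiv (eq_on_partial U oU _ _ y i H)//.
rewrite (rational_partialD U)// ?(partial_sumM U)//;
  try by [move=> k; rational|rational].
rewrite -sumrN -!big_split/=; apply: eq_bigr => r _.
have -> : partial r (hess i j) y = partial i (hess j r) y.
  rewrite partial_hessC//; apply: (eq_on_partial U) => // z Uz.
  exact: hessC.
by rewrite /bcurv /bcoef /hessian; ring.
Qed.

Lemma dhess_hderivE l i j k y : U y -> dhess_hderiv l i j k y =
  \sum_r bcoef r k l y * partial r (hess i j) y
  + \sum_r partial k (hess i r) y * bcoef r j l y
  + \sum_r partial k (hess j r) y * bcoef r i l y
  + \sum_r hess i r y * bcurv r k j l y
  + \sum_r hess j r y * bcurv r k i l y
  + partial k (landsberg i j l) y.
Proof.
move=> Uy; have H z : U z -> _ := hess_hderivE l i j z.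
have := eq_on_partial U oU _ _ y k H Uy.
rewrite {1}/hess_hderiv (rational_partialB U) ?(rational_partialD U)
  ?(partial_sumM U)//; try by [move=> ?; rational|rational].
rewrite !big_split/= => /eqP; rewrite subr_eq => /eqP E.
rewrite /dhess_hderiv E.
have -> : \sum_r partial l (G r) y * partial k (partial r (hess i j)) y =
    \sum_r partial l (G r) y * partial r (partial k (hess i j)) y.
  by apply: eq_bigr => r _; rewrite (partialC U).
by rewrite /bcurv /bcoef; ring.
Qed.

Lemma bcurv_contraction r i j y : U y -> \sum_l y 0 l * bcurv r i j l y = 0.
Proof.
move=> Uy.
have h1 := homogeneous_partial U oU 2 (G r) j (rG r) (spray_homogeneous r).
have h2 : homogeneous U (2 - 1 - 1) (bcoef r i j).
  by apply: homogeneous_partial => //; rational.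
transitivity (euler (bcoef r i j) y); last first.
  by rewrite h2// -addrA -opprD subrr mul0r.
rewrite /euler; apply: eq_bigr => l _; congr (_ * _).
by rewrite bcurvCr// bcurvC.
Qed.

Lemma landsberg_contraction i j y : U y -> \sum_l y 0 l * landsberg i j l y = 0.
Proof.
move=> Uy; rewrite /landsberg; under eq_bigr do rewrite mulr_sumr.
rewrite exchange_big big1//= => r _.
under eq_bigr do rewrite mulrCA.
by rewrite -mulr_sumr bcurv_contraction// mulr0.
Qed.

(** Differentiate [y^l e_ijl = 0] in [y^k]. This is the origin of the minus sign in
    [h_ij.k|l y^l = - e_ijk]. *)
Lemma partial_landsberg_contraction i j k y : U y ->
  \sum_l y 0 l * partial k (landsberg i j l) y = - landsberg i j k y.
Proof.
move=> Uy; have H z : U z -> _ := landsberg_contraction i j z.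
have := eq_on_partial U oU _ (fun=> 0) y k H Uy.
rewrite partial_cst (partial_contraction U)// => /eqP.
by rewrite addrC addr_eq0 => /eqP.
Qed.

Lemma landsbergC i j k y : U y -> landsberg i j k y = landsberg j i k y.
Proof. by move=> Uy; apply: eq_bigr => r _; rewrite bcurvC. Qed.

Lemma landsbergCr i j k y : U y -> landsberg i j k y = landsberg i k j y.
Proof. by move=> Uy; apply: eq_bigr => r _; rewrite bcurvCr. Qed.

(** * The metrical connection of the Hessian compared with the Berwald connection *)

Section Metrical.
Context (y : V) (L : 'I_n -> 'I_n -> 'I_n -> R).
Hypothesis Uy : U y.
Hypothesis christoffel : forall s j k, \sum_i hess s i y * L i j k =
  2^-1 * (hess_hderiv k s j y + hess_hderiv j s k y - hess_hderiv s j k y).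

Definition cartan_hcov (i j k l : 'I_n) : R :=
  dhess_hderiv l i j k y
  - (\sum_r L r i l * partial k (hess r j) y)
  - (\sum_r L r j l * partial k (hess i r) y)
  - (\sum_r L r k l * partial r (hess i j) y).

(** The difference of two connections; every formula for [L] is reduced to the Berwald one plus a
    correction in [D]. *)
Let D i j k : R := L i j k - bcoef i j k y.

(** In the Christoffel combination the Berwald terms lowered by [hess k] and [hess j] cancel, those
    lowered by [hess s] add up, and the three symmetric [landsberg] terms leave one. *)
Let hess_D s j k : \sum_i hess s i y * D i j k = 2^-1 * landsberg s j k y.
Proof.
rewrite /D; under eq_bigr do rewrite mulrBr.
rewrite sumrB christoffel !hess_hderivE//.
have -> : \sum_r hess s r y * bcoef r k j y = \sum_r hess s r y * bcoef r j k y.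
  by apply: eq_bigr => r _; rewrite /bcoef (partialC U).
have -> : \sum_r hess k r y * bcoef r s j y = \sum_r hess k r y * bcoef r j s y.
  by apply: eq_bigr => r _; rewrite /bcoef (partialC U).
have -> : \sum_r hess j r y * bcoef r s k y = \sum_r hess j r y * bcoef r k s y.
  by apply: eq_bigr => r _; rewrite /bcoef (partialC U).
rewrite (landsbergCr s k j)// (landsbergCr j k s)// (landsbergC j s k)//.
by field.
Qed.

Let cartan_hcovE i j k l : cartan_hcov i j k l =
  \sum_r hess i r y * bcurv r k j l y + \sum_r hess j r y * bcurv r k i l y
  + partial k (landsberg i j l) y
  - (\sum_r D r i l * partial k (hess r j) y)
  - (\sum_r D r j l * partial k (hess i r) y)
  - (\sum_r D r k l * partial r (hess i j) y).
Proof.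
have LE (f : 'I_n -> R) a b : \sum_r L r a b * f r =
    \sum_r D r a b * f r + \sum_r f r * bcoef r a b y.
  by rewrite -big_split; apply: eq_bigr => r _; rewrite /D/=; ring.
rewrite /cartan_hcov dhess_hderivE// !LE.
have -> : \sum_r partial k (hess j r) y * bcoef r i l y =
    \sum_r partial k (hess r j) y * bcoef r i l y.
  apply: eq_bigr => r _; congr (_ * _); apply: (eq_on_partial U) => // z Uz.
  exact: hessC.
have -> : \sum_r bcoef r k l y * partial r (hess i j) y =
    \sum_r partial r (hess i j) y * bcoef r k l y.
  by apply: eq_bigr => r _; rewrite mulrC.
by ring.
Qed.

(** Contraction with [y] kills [bcurv], and kills [D] because it kills [landsberg]; only the term
    with the derivative of [landsberg] survives. *)
Lemma cartan_hcov_contraction i j k :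
  \sum_l cartan_hcov i j k l * y 0 l = - landsberg i j k y.
Proof.
have D0 r a : \sum_l y 0 l * D r a l = 0.
  move: r; apply: (hess_inj y (fun r => \sum_l y 0 l * D r a l)) => // s.
  transitivity (2^-1 * \sum_l y 0 l * landsberg s a l y); last first.
    by rewrite landsberg_contraction// mulr0.
  under eq_bigr do rewrite mulr_sumr.
  rewrite exchange_big/= mulr_sumr; apply: eq_bigr => l _.
  rewrite mulrCA -hess_D mulr_sumr.
  by apply: eq_bigr => r _; ring.
have S0 (f : 'I_n -> R) a : \sum_l y 0 l * (\sum_r D r a l * f r) = 0.
  under eq_bigr do rewrite mulr_sumr.
  rewrite exchange_big big1//= => r _.
  under eq_bigr do rewrite mulrA.
  by rewrite -mulr_suml D0 mul0r.
have C0 (f : 'I_n -> R) a b :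
    \sum_l y 0 l * (\sum_r f r * bcurv r a b l y) = 0.
  under eq_bigr do rewrite mulr_sumr.
  rewrite exchange_big big1//= => r _.
  under eq_bigr do rewrite mulrCA.
  by rewrite -mulr_sumr bcurv_contraction// mulr0.
under eq_bigr do rewrite cartan_hcovE mulrC !mulrBr !mulrDr.
by rewrite !sumrB !big_split/= !S0 !C0 partial_landsberg_contraction//; ring.
Qed.

(** The vanishing of [landsberg] gives [D = 0] at [y]; it is assumed on all of [U] because a
    derivative of [landsberg] also occurs. *)
Lemma cartan_hcov_landsberg :
  (forall z, U z -> forall i j k, landsberg i j k z = 0) ->
  forall i j k l, cartan_hcov i j k l =
  \sum_r hess i r y * bcurv r k j l y + \sum_r hess j r y * bcurv r k i l y.
Proof.
move=> e0 i j k l.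
have D0 r a b : D r a b = 0.
  move: r; apply: (hess_inj y (fun r => D r a b)) => // s.
  by rewrite hess_D e0// mulr0.
rewrite cartan_hcovE (eq_on_partial U oU _ (fun=> 0) y k); first last.
- by [].
- by move=> z Uz; exact: e0.
have S0 (f : 'I_n -> R) a b : \sum_r D r a b * f r = 0.
  by apply: big1 => r _; rewrite D0 mul0r.
by rewrite partial_cst !S0 !subr0 addr0.
Qed.

Lemma bcurv_eq0_cartan_hcov :
  (forall z, U z -> forall r i j k, bcurv r i j k z = 0) ->
  forall i j k l, cartan_hcov i j k l = 0.
Proof.
move=> b0 i j k l; rewrite cartan_hcov_landsberg; last first.
  by move=> z Uz i' j' k'; rewrite /landsberg big1// => r _; rewrite b0// mulr0.
by rewrite !big1 ?addr0// => r _; rewrite b0// mulr0.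
Qed.

(* Lowering the first index of [bcurv] yields [S], which is symmetric in its
   last three indices and skew in its first two, hence zero. *)
Lemma cartan_hcov_eq0_bcurv :
  (forall z, U z -> forall i j k, landsberg i j k z = 0) ->
  (forall i j k l, cartan_hcov i j k l = 0) ->
  forall r i j k, bcurv r i j k y = 0.
Proof.
move=> e0 c0 r j k l; move: r.
pose S i j k l := \sum_r hess i r y * bcurv r j k l y.
have S1 i a b c : S i a b c = S i b a c.
  by apply: eq_bigr => r _; rewrite bcurvC.
have S2 i a b c : S i a b c = S i a c b.
  by apply: eq_bigr => r _; rewrite bcurvCr.
have S3 i a b c : S i b a c = - S a b i c.
  by apply/eqP; rewrite -addr_eq0 /S -cartan_hcov_landsberg// c0.
apply: (hess_inj y (fun r => bcurv r j k l y)) => // i.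
rewrite -/(S i j k l).
(* Two ways to exchange [i] and [j]: [A] uses the sign rule [S3] twice, [B] once, so [S] equals its
   own opposite. *)
have A : S i j k l = S j i k l by rewrite S3 S1 S3 opprK.
have B : S i j k l = - S j i k l by rewrite S1 S3 S1.
by lra.
Qed.

End Metrical.
End SprayIdentities.

(** * Symmetric forms depending on a parameter *)

Section Forms.
Context {R : realType} {n : nat}.
Local Notation V := 'rV[R]_n.
Implicit Types (q : nat) (b : seq 'I_n -> R).

(* The value at [(y, ..., y)] of the [q]-linear form with coefficients [b]. *)
Fixpoint form q b : V -> R := fun y =>
  if q is q'.+1 then \sum_i y 0 i * form q' (fun s => b (i :: s)) y
  else b [::].

Definition symmetric_coef q b : Prop :=
  forall s t, size s = q -> perm_eq s t -> b s = b t.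

Lemma symmetric_coef_cons q b i :
  symmetric_coef q.+1 b -> symmetric_coef q (fun s => b (i :: s)).
Proof.
by move=> sb s t sq st; apply: sb; rewrite /= ?sq// perm_cons.
Qed.

Lemma eq_form q b b' y : (forall s, size s = q -> b s = b' s) ->
  form q b y = form q b' y.
Proof.
elim: q b b' => [|q IH] b b' bb' /=; first exact: bb'.
apply: eq_bigr => i _; congr (_ * _); apply: IH => s sq.
by apply: bb'; rewrite /= sq.
Qed.

Lemma formZ q (c : R) b y : form q (fun s => c * b s) y = c * form q b y.
Proof.
elim: q b => //= q IH b; rewrite mulr_sumr.
by apply: eq_bigr => i _; rewrite (IH (fun s => b (i :: s))) mulrCA.
Qed.

Lemma rational_form (U : set V) q b : rational_on U (form q b).
Proof.
elim: q b => [|q IH] b; first exact: rational_cst.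
by apply: rational_sum => i _; apply: rationalM; [exact: rational_coord|].
Qed.

Lemma form_tuple q b (y : V) :
  \sum_(I : q.-tuple 'I_n) b I * \prod_(i <- I) y 0 i = form q b y.
Proof.
elim: q b => [|q IH] b /=.
  rewrite (big_pred1 [tuple]) => [|I]; last by rewrite [I]tuple0 /= eqxx.
  by rewrite big_nil mulr1.
rewrite (reindex (fun u : 'I_n * q.-tuple 'I_n => [tuple of u.1 :: u.2])) /=.
  rewrite -(pair_bigA _ (fun i (I : q.-tuple 'I_n) =>
    b (i :: I) * \prod_(k <- i :: I) y 0 k))/=.
  apply: eq_bigr => i _; rewrite -IH mulr_sumr.
  by apply: eq_bigr => I _; rewrite big_cons; ring.
exists (fun I : q.+1.-tuple 'I_n => (thead I, [tuple of behead I])).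
  by move=> [i I] _ /=; congr pair; apply: val_inj.
by move=> I _; rewrite [RHS](tuple_eta I); apply: val_inj.
Qed.

Let oT : open (@classical_sets.setT V) := openT.

(** The outer slot contributes one copy and the inner slots, by induction, [q] copies, with [k]
    moved to the front by symmetry. In degree 0 the factor [q%:R] vanishes, so the truncated [q.-1]
    is harmless. *)
Lemma partial_form q b k y : symmetric_coef q b ->
  partial k (form q b) y = q%:R * form q.-1 (fun s => b (k :: s)) y.
Proof.
elim: q b => [|q IH] b sb; first by rewrite mul0r partial_cst.
rewrite (partial_contraction classical_sets.setT)//; last first.
  by move=> i; exact: rational_form.
rewrite -natr1 mulrDl mul1r addrC; congr (_ + _).
under eq_bigr do rewrite (IH _ (symmetric_coef_cons _ _ _ sb)).
case: q IH sb => [|q] _ sb /=.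
  by rewrite mul0r big1// => i _; rewrite mul0r mulr0.
rewrite mulr_sumr; apply: eq_bigr => i _; rewrite mulrCA.
congr (_ * (_ * _)); apply: eq_form => s sq; apply: sb; rewrite /= ?sq//.
by rewrite -[i :: k :: s]/([:: i] ++ [:: k] ++ s) perm_catCA.
Qed.

Lemma homogeneous_form (U : set V) q b : symmetric_coef q b ->
  homogeneous U q%:R (form q b).
Proof.
move=> sb y _; rewrite /euler; under eq_bigr do rewrite partial_form//.
case: q sb => [|q] sb.
  by rewrite big1 ?mul0r// => i _; rewrite mul0r mulr0.
by rewrite mulr_sumr; apply: eq_bigr => i _; rewrite mulrCA.
Qed.

Lemma partial_form_coef q (b : V -> seq 'I_n -> R) y x :
  (forall s, size s = q -> partially_derivable (fun x' => b x' s) x) ->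
  partially_derivable (fun x' => form q (b x') y) x /\
  forall l, partial l (fun x' => form q (b x') y) x =
    form q (fun s => partial l (fun x' => b x' s) x) y.
Proof.
elim: q b => [|q IH] b db; first by split => // ; exact: db.
have IH' i := IH (fun x' s => b x' (i :: s))
  (fun s sq => db (i :: s) (congr1 S sq)).
have S : forall r : seq 'I_n,
    partially_derivable (fun x' => \sum_(i <- r)
      y 0 i * form q (fun s => b x' (i :: s)) y) x /\
    forall l, partial l (fun x' => \sum_(i <- r)
      y 0 i * form q (fun s => b x' (i :: s)) y) x =
    \sum_(i <- r) y 0 i *
      form q (fun s => partial l (fun x' => b x' (i :: s)) x) y.
  elim=> [|i r [dr er]].
    have E : (fun x' => \sum_(i <- [::])
        y 0 i * form q (fun s => b x' (i :: s)) y) = (fun=> 0).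
      by apply: funext => x'; rewrite big_nil.
    rewrite E; split=> [|l]; first exact: partially_derivable_cst.
    by rewrite partial_cst big_nil.
  have [di ei] := IH' i.
  have E : (fun x' => \sum_(j <- i :: r)
      y 0 j * form q (fun s => b x' (j :: s)) y) =
    (fun x' => y 0 i * form q (fun s => b x' (i :: s)) y + \sum_(j <- r)
      y 0 j * form q (fun s => b x' (j :: s)) y).
    by apply: funext => x'; rewrite big_cons.
  have dM := partially_derivableZ (y 0 i) _ _ di.
  rewrite E; split => [|l]; first exact: partially_derivableD.
  rewrite partialD// er big_cons; congr (_ + _).
  by rewrite partialZ// ei.
exact: S.
Qed.

End Forms.

(** * Chain rule and derivatives of the squared root *)

Section ChainRule.
Context {R : realType}.

Lemma derive_line {n : nat} (f : 'rV[R]_n -> R) (y v : 'rV[R]_n) :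
  'D_v f y = (fun t : R => f (t *: v + y))^`()%classic 0.
Proof.
rewrite derive1E /derive.
suff -> : (fun h : R => h^-1 *: (f (h *: v + y) - f y)) =
    (fun h : R => h^-1 *: (f ((h *: 1 + 0) *: v + y) - f (0 *: v + y))) by [].
by apply: funext => h; rewrite scale0r add0r addr0 [h *: 1]mulr1.
Qed.

(** A partial derivative only sees a coordinate line, where the one-variable chain rule applies. *)
Lemma partial_comp {n : nat} (g : R -> R) (f : 'rV[R]_n -> R) y i :
  partially_derivable f y -> derivable g (f y) 1 ->
  derivable (fun z => g (f z)) y (basis_vec R i) /\
  partial i (fun z => g (f z)) y = g^`()%classic (f y) * partial i f y.
Proof.
move=> /partially_derivableP df dg.
pose l (t : R) := f (t *: basis_vec R i + y).
have dl : derivable l 0 1 by exact: (derivable1P f y (basis_vec R i)).1 (df i).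
have l0 : l 0 = f y by rewrite /l scale0r add0r.
have dg' : derivable g (l 0) 1 by rewrite l0.
have glE : (fun t : R => g (f (t *: basis_vec R i + y))) = g \o l by [].
split; last by rewrite !partialE !derive_line -/l -l0 glE derive1_comp.
apply: (derivable1P (fun z => g (f z)) y (basis_vec R i)).2; rewrite glE.
apply: (derivable1_diffP _ _).2; apply: differentiable_comp.
  exact: (derivable1_diffP _ _).1.
exact: (derivable1_diffP _ _).1.
Qed.

(* The square of a real [p]-th root, with the sign conventions of
   [root_metric] and [e = 1 / p]. *)
Definition root_sq (e u : R) : R := (Num.sg u * (`|u| `^ e)) ^+ 2.

Lemma root_sq_neq0 (e u : R) : u != 0 -> root_sq e u != 0.
Proof.
move=> u0; rewrite expf_neq0// mulf_neq0 ?sgr_eq0//.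
by rewrite powR_eq0 normr_eq0 (negbTE u0).
Qed.

Lemma is_derive_root_sq (e u : R) : u != 0 ->
  is_derive u (1 : R) (root_sq e) (2 * e * (root_sq e u / u)).
Proof.
have pos (v : R) : 0 < v ->
    is_derive v (1 : R) (root_sq e) (2 * e * (root_sq e v / v)).
  move=> v0; pose g : R -> R := (@powR R)^~ e.
  have E : \near v, (g ^+ 2) v = root_sq e v.
    near=> w; have w0 : 0 < w by near: w; exact: lt_nbhsr.
    by rewrite /root_sq gtr0_sg// mul1r gtr0_norm.
  have dg : is_derive v (1 : R) g (e * v `^ (e - 1)) := is_derive1_powR e v0.
  apply: (near_eq_is_derive E); apply: (is_derive_eq (is_deriveX 2 dg)).
  rewrite /g /root_sq gtr0_sg// mul1r gtr0_norm// powRB; last first.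
    by rewrite (@gt_eqF _ _ v) ?implybT.
  by rewrite powRr1 ?ltW// /GRing.scale/= expr1 expr2; field; rewrite gt_eqF.
rewrite neq_lt => /orP[u0|]; last exact: pos.
(* Squaring removes the sign, so the negative case is the reflection of the positive one. *)
have even (v : R) : root_sq e (- v) = root_sq e v.
  by rewrite /root_sq sgrN normrN mulNr sqrrN.
have Nu0 : 0 < - u by rewrite oppr_gt0.
have evenE : root_sq e \o -%R = root_sq e.
  by apply: funext => v /=; rewrite even.
have := is_derive1_comp (pos _ Nu0) (is_deriveNid u (1 : R)).
rewrite evenE => H; apply: (is_derive_eq H).
by rewrite even invrN; ring.
Unshelve. all: by end_near. Qed.

Section RootSqComposition.
Context {n : nat} (e K : R) (f : 'rV[R]_n -> R) (y : 'rV[R]_n) (i : 'I_n).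
Hypotheses (K0 : K != 0) (df : partially_derivable f y) (f0 : f y != 0).

Let dKf := partially_derivableZ K f y df.

Lemma partial_root_sq :
  partially_derivable (fun z => root_sq e (K * f z)) y /\
  partial i (fun z => root_sq e (K * f z)) y =
    2 * e * (root_sq e (K * f y) / f y) * partial i f y.
Proof.
have Kf0 : K * f y != 0 by rewrite mulf_neq0.
have [d E] := is_derive_root_sq e _ Kf0.
have H j := partial_comp (root_sq e) _ y j dKf d.
split; first by apply/partially_derivableP => j; have [] := H j.
by rewrite (H i).2 derive1E E partialZ//; field; rewrite f0 K0.
Qed.

(* [phi = root_sq e (K f)] satisfies [phi' = 2 e phi f' / f], so that
   [phi / f] is again reproduced by derivation. *)
Lemma partial_root_sqM (g : 'rV[R]_n -> R) : partially_derivable g y ->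
  partially_derivable (fun z => root_sq e (K * f z) / f z * g z) y /\
  partial i (fun z => root_sq e (K * f z) / f z * g z) y =
    root_sq e (K * f y) / f y *
    ((2 * e - 1) / f y * partial i f y * g y + partial i g y).
Proof.
move=> dg; have [dr Er] := partial_root_sq.
have dV := partially_derivableV f y f0 df.
have dq := partially_derivableM _ _ _ dr dV.
split; first exact: partially_derivableM.
by rewrite partialM// partialM// partialV// Er; field; exact: f0.
Qed.

End RootSqComposition.
End ChainRule.

(** * Invertible matrices in index notation *)

Section MatrixFacts.
Context {F : fieldType} {n : nat} (A : 'M[F]_n).

Lemma mul_inj_unitmx :
  (forall v : 'I_n -> F, (forall i, \sum_j A i j * v j = 0) ->
     forall j, v j = 0) -> A \in unitmx.
Proof.
move=> inj; rewrite -unitmx_tr -row_free_unit -kermx_eq0.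
apply/eqP/row_matrixP => i; rewrite row0; apply/rowP => j.
rewrite [LHS]mxE [RHS]mxE; move: j; apply: (inj (fun j => kermx A^T i j)) => k.
have /matrixP/(_ i k) := mulmx_ker A^T; rewrite [LHS]mxE [RHS]mxE => E.
by rewrite -[RHS]E; apply: eq_bigr => l _; rewrite mulrC [A^T _ _]mxE.
Qed.

Hypothesis uA : A \in unitmx.

Lemma sum_mul_invmx (x : 'I_n -> F) s :
  \sum_i A s i * (\sum_t invmx A i t * x t) = x s.
Proof.
have /matrixP/(_ s 0) := mulKVmx uA (\col_t x t).
rewrite !mxE => <-; apply: eq_bigr => i _; congr (_ * _).
by rewrite mxE; apply: eq_bigr => t _; rewrite mxE.
Qed.

Lemma sum_invmx_mul (x : 'I_n -> F) s :
  \sum_i invmx A s i * (\sum_t A i t * x t) = x s.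
Proof.
have /matrixP/(_ s 0) := mulKmx uA (\col_t x t).
rewrite !mxE => <-; apply: eq_bigr => i _; congr (_ * _).
by rewrite mxE; apply: eq_bigr => t _; rewrite mxE.
Qed.

Lemma unitmx_mul_inj (v : 'I_n -> F) :
  (forall i, \sum_j A i j * v j = 0) -> forall j, v j = 0.
Proof.
move=> v0 j; rewrite -(sum_invmx_mul v) big1// => i _.
by rewrite v0 mulr0.
Qed.

End MatrixFacts.

(** * Forms whose coefficients depend on the base point *)

Section FormFamilies.
Context {R : realType} {n : nat}.
Local Notation V := 'rV[R]_n.
Context (W : set V) (oW : open W).
Implicit Types (q : nat) (b : V -> seq 'I_n -> R).

Definition form_family q b : Prop := forall x, W x ->
  symmetric_coef q (b x) /\
  forall s, size s = q -> partially_derivable (fun x' => b x' s) x.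

Definition coef_dx (l : 'I_n) b : V -> seq 'I_n -> R :=
  fun x s => partial l (fun x' => b x' s) x.

Definition coef_dy q (k : 'I_n) b : V -> seq 'I_n -> R :=
  fun x s => q%:R * b x (k :: s).

Lemma partial_family q b k x y : form_family q b -> W x ->
  partial k (form q (b x)) y = form q.-1 (coef_dy q k b x) y.
Proof. by move=> fb Wx; rewrite partial_form ?formZ//; have [] := fb x Wx. Qed.

Lemma coef_dx_symmetric q b l x :
  form_family q b -> W x -> symmetric_coef q (coef_dx l b x).
Proof.
move=> fb Wx s t sq st; apply: (eq_on_partial W oW _ _ x l _ Wx) => z Wz.
by have [sz _] := fb z Wz; exact: sz.
Qed.

Lemma coef_dy_family q b k :
  form_family q b -> form_family q.-1 (coef_dy q k b).
Proof.
case: q => [|q] fb x Wx.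
  have E x' s : coef_dy 0 k b x' s = 0 by rewrite /coef_dy mul0r.
  split=> [s t _ _|s _]; first by rewrite !E.
  by under [fun _ => _]funext do rewrite E; exact: partially_derivable_cst.
have [sb db] := fb x Wx; split.
  move=> s t sq st; congr (_ * _); apply: sb; rewrite /= ?sq//.
  by rewrite perm_cons.
by move=> s sq; apply: partially_derivableZ; apply: db; rewrite /= sq.
Qed.

(** Both derivatives act on coefficients: [d/dy^k] fixes one index and multiplies by [q], a constant
    that passes through [d/dx^l]. *)
Lemma coef_dx_dy q b l k x y : form_family q b -> W x ->
  form q.-1 (coef_dx l (coef_dy q k b) x) y =
  partial k (form q (coef_dx l b x)) y.
Proof.
move=> fb Wx; rewrite partial_form; last exact: coef_dx_symmetric.
rewrite -formZ; apply: eq_form => s sq; case: q fb sq => [|q] fb /= sq.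
  rewrite mul0r -[RHS](partial_cst l 0 x); apply: eq_partial => x'.
  by rewrite /coef_dy mul0r.
have [_ db] := fb x Wx; rewrite /coef_dx /coef_dy partialZ//.
by apply: db; rewrite /= sq.
Qed.

Lemma family_dx q b x y : form_family q b -> W x ->
  partially_derivable (fun x' => form q (b x') y) x /\
  forall l, partial l (fun x' => form q (b x') y) x = form q (coef_dx l b x) y.
Proof. by move=> fb Wx; apply: partial_form_coef; have [] := fb x Wx. Qed.

Lemma family_dx1 q b k x y : form_family q b -> W x ->
  partially_derivable (fun x' => partial k (form q (b x')) y) x /\
  forall l, partial l (fun x' => partial k (form q (b x')) y) x =
    partial k (form q (coef_dx l b x)) y.
Proof.
move=> fb Wx; have E z : W z -> form q.-1 (coef_dy q k b z) y =
    partial k (form q (b z)) y by move=> Wz; rewrite -partial_family.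
have [d e] := family_dx _ _ x y (coef_dy_family _ _ k fb) Wx.
split; first exact: near_eq_partially_derivable (near_on W oW _ x E Wx) d.
by move=> l; rewrite -(eq_on_partial W oW _ _ x l E Wx) e coef_dx_dy.
Qed.

Lemma family_dx2 q b i j x y : form_family q b -> W x ->
  partially_derivable (fun x' => partial i (partial j (form q (b x'))) y) x /\
  forall l, partial l (fun x' => partial i (partial j (form q (b x'))) y) x =
    partial i (partial j (form q (coef_dx l b x))) y.
Proof.
move=> fb Wx; have E z : W z -> partial i (form q.-1 (coef_dy q j b z)) y =
    partial i (partial j (form q (b z))) y.
  by move=> Wz; apply: eq_partial => y'; rewrite -partial_family.
have [d e] := family_dx1 _ _ i x y (coef_dy_family _ _ j fb) Wx.
split; first exact: near_eq_partially_derivable (near_on W oW _ x E Wx) d.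
move=> l; rewrite -(eq_on_partial W oW _ _ x l E Wx) e.
by apply: eq_partial => y'; rewrite coef_dx_dy.
Qed.

Lemma family_dx3 q b k i j l x y : form_family q b -> W x ->
  partial l (fun x' => partial k (partial i (partial j (form q (b x')))) y) x =
  partial k (partial i (partial j (form q (coef_dx l b x)))) y.
Proof.
move=> fb Wx.
have E z : W z -> partial k (partial i (form q.-1 (coef_dy q j b z))) y =
    partial k (partial i (partial j (form q (b z)))) y.
  move=> Wz; apply: eq_partial => y'; apply: eq_partial => y''.
  by rewrite -partial_family.
have [_ e] := family_dx2 _ _ k i x y (coef_dy_family _ _ j fb) Wx.
rewrite -(eq_on_partial W oW _ _ x l E Wx) e.
by apply: eq_partial => y'; apply: eq_partial => y''; rewrite coef_dx_dy.
Qed.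

End FormFamilies.

(** * Root metrics in a chart *)

Section Slices.
Context {R : realType} {n : nat}.
Local Notation V := 'rV[R]_n.
Implicit Types (F : V * V -> R) (x y v : V).

Lemma differentiable_slice F x y :
  differentiable F (x, y) -> differentiable (fun z => F (x, z)) y.
Proof.
by move=> dF; exact: (@differentiable_comp _ _ _ _ (fun z => (x, z)) F).
Qed.

Lemma derive_slice F x y v :
  'D_(0, v) F (x, y) = 'D_v (fun z => F (x, z)) y.
Proof.
rewrite /derive; suff -> :
    (fun h : R => h^-1 *: (F (h *: (0, v) + (x, y)) - F (x, y))) =
    (fun h : R => h^-1 *: (F (x, h *: v + y) - F (x, y))) by [].
apply: funext => h; congr (_ *: (F _ - _)).
by congr pair; rewrite /= scaler0 add0r.
Qed.

Lemma open_slice_fst (A : set (V * V)) y : open A -> open (fun x => A (x, y)).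
Proof.
move=> oA; apply: (@open_comp _ _ (fun x => (x, y)) A) => // x _.
by apply: differentiable_continuous; apply: differentiable_pair.
Qed.

Lemma open_slice_snd (A : set (V * V)) x : open A -> open (fun y => A (x, y)).
Proof.
move=> oA; apply: (@open_comp _ _ (fun y => (x, y)) A) => // y _.
by apply: differentiable_continuous; apply: differentiable_pair.
Qed.

Lemma open_neq0 : open (fun y : V => y <> 0).
Proof.
have : open (~` [set (0 : V)])%classic.
  apply: closed_openC; apply: accessible_closed_set1.
  by apply: hausdorff_accessible; exact: norm_hausdorff.
exact.
Qed.

End Slices.

Lemma form_scale {R : realType} {n : nat} q (b : seq 'I_n -> R) (t : R) y :
  form q b (t *: y) = t ^+ q * form q b y.
Proof.
elim: q b => [|q IH] b /=; first by rewrite mul1r.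
rewrite mulr_sumr; apply: eq_bigr => i _.
by rewrite IH mxE exprS; ring.
Qed.

(** * From the root metric in a chart to the spray identities *)

Section LocalForm.
Context {R : realType} {n m : nat}.
Local Notation V := 'rV[R]_n.
Context (a : V -> m.+2.-tuple 'I_n -> R) (W : set V) (oW : open W).
Hypothesis a_differentiable :
  forall x I, W x -> differentiable (fun x' => a x' I) x.
Hypothesis a_symmetric : forall x (I J : m.+2.-tuple 'I_n), W x ->
  perm_eq I J -> a x I = a x J.

Definition hess_scale : R := m.+2%:R * m.+1%:R.
Local Notation K := hess_scale.

Lemma hess_scale_neq0 : K != 0.
Proof. by rewrite mulf_neq0 ?pnatr_eq0. Qed.

(** [form] takes coefficients on lists; lists of the wrong length get the value 0 and never occur in
    degree [m.+2]. *)
Definition scaled_coef (x : V) (s : seq 'I_n) : R :=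
  K^-1 * (if (insub s : option (m.+2.-tuple 'I_n)) is Some t then a x t else 0).

Definition scaled_form (x : V) : V -> R := form m.+2 (scaled_coef x).

Definition scaled_form_dx (x : V) (l : 'I_n) : V -> R :=
  form m.+2 (coef_dx l scaled_coef x).

Local Notation P := scaled_form.
Local Notation Q := scaled_form_dx.

Lemma scaled_coef_tuple x (I : m.+2.-tuple 'I_n) : K * scaled_coef x I = a x I.
Proof. by rewrite /scaled_coef valK mulVKf ?hess_scale_neq0. Qed.

Lemma scaled_coef_family : form_family W m.+2 scaled_coef.
Proof.
move=> x Wx; split=> [s t ss st|s ss]; rewrite /scaled_coef.
  have st' : size t == m.+2 by rewrite -(perm_size st) ss.
  have ss' : size s == m.+2 by rewrite ss.
  rewrite (insubT (fun s => size s == m.+2) ss').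
  rewrite (insubT (fun s => size s == m.+2) st').
  by congr (_ * _); apply: a_symmetric.
have ss' : size s == m.+2 by rewrite ss.
rewrite (insubT (fun s => size s == m.+2) ss').
apply: partially_derivableZ; apply: differentiable_partially.
exact: a_differentiable.
Qed.

Lemma mform_scaled x y : mform a x y = K * P x y.
Proof.
rewrite /P -formZ -form_tuple; apply: eq_bigr => I _.
by rewrite scaled_coef_tuple.
Qed.

Lemma flag_metric_hessian x i j y : W x ->
  flag_metric a i j x y = hessian (P x) i j y.
Proof.
move=> Wx; have [sb _] := scaled_coef_family x Wx.
have fb := scaled_coef_family.
rewrite /hessian (eq_partial i (partial j _)
  (form m.+1 (coef_dy m.+2 j scaled_coef x))); last first.
  by move=> z; rewrite (partial_family W).
rewrite (partial_family W)//; last exact: (coef_dy_family W m.+2).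
rewrite /flag_metric.
transitivity (form m (fun s => K * scaled_coef x (i :: j :: s)) y).
  rewrite -form_tuple; apply: eq_bigr => I _; congr (_ * _).
  rewrite -[RHS]/(K * scaled_coef x [tuple of i :: j :: I]).
  by rewrite scaled_coef_tuple.
apply: eq_form => s ss; rewrite /coef_dy mulrA [m.+1%:R * _]mulrC.
congr (_ * _); apply: sb; rewrite /= ?ss//.
by rewrite -[i :: j :: s]/([:: i] ++ [:: j] ++ s) perm_catCA.
Qed.

Lemma homogeneous_scaled_form U x : W x -> homogeneous U m.+2%:R (P x).
Proof.
by move=> Wx; apply: homogeneous_form; have [] := scaled_coef_family x Wx.
Qed.

Lemma homogeneous_scaled_form_dx U x l : W x -> homogeneous U m.+2%:R (Q x l).
Proof.
move=> Wx; apply: homogeneous_form.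
exact: (coef_dx_symmetric W oW _ _ _ _ scaled_coef_family).
Qed.

Lemma scaled_form_scale x t y : P x (t *: y) = t ^+ m.+2 * P x y.
Proof. exact: form_scale. Qed.

Let e : R := (m.+2%:R)^-1.

Lemma sqF_root_sq x y : sqF a x y = root_sq e (K * P x y).
Proof. by rewrite -mform_scaled. Qed.

Lemma root_metric_eq0 x y : P x y = 0 -> root_metric a x y = 0.
Proof. by move=> P0; rewrite /root_metric mform_scaled P0 mulr0 sgr0 mul0r. Qed.

Definition regular x y : Prop := W x /\ regular_point a x y.

(** The regular points are cut out by an open set of the product, so they are open in [y] for fixed
    [x] and in [x] for fixed [y]; derivatives in both variables are taken of identities valid only
    there. *)
Lemma regular_open_set : exists A : set (V * V), open A /\
  (forall x y, regular x y <-> [/\ W x, y <> 0 & A (x, y)]) /\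
  forall x y, A (x, y) -> smooth_at (fun w => root_metric a w.1 w.2) (x, y).
Proof.
exists (interior [set z | root_defined a z.1 z.2 /\
  smooth_at (fun w => root_metric a w.1 w.2) z])%classic.
split; first exact: open_interior.
split=> x y; last by move=> /interior_subset[].
by split=> [[Wx [y0 nz]]|[Wx y0 nz]].
Qed.

Lemma open_regular_fiber x : open (fun y => regular x y).
Proof.
have [A [oA [AE _]]] := regular_open_set.
have oy := openI open_neq0 (open_slice_snd A x oA).
have [Wx|nWx] := pselect (W x).
  suff -> : (fun y => regular x y) =
     ((fun y : V => y <> 0%R) `&` (fun y => A (x, y)))%classic by [].
  apply/seteqP; split=> y /=; first by move=> /AE[].
  by move=> [y0 Axy]; apply/AE.
suff -> : (fun y => regular x y) = set0 by exact: open0.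
by apply/seteqP; split=> y // [].
Qed.

Lemma open_regular_base y : open (fun x => regular x y).
Proof.
have [A [oA [AE _]]] := regular_open_set.
have ox := openI oW (open_slice_fst A y oA).
have [y0|ny0] := pselect (y <> 0).
  suff -> : (fun x => regular x y) = (W `&` (fun x => A (x, y)))%classic by [].
  apply/seteqP; split=> x /=; first by move=> /AE[].
  by move=> [Wx Axy]; apply/AE.
suff -> : (fun x => regular x y) = set0 by exact: open0.
by apply/seteqP; split=> x // /AE[_ /ny0].
Qed.

Lemma regular_smooth x y : regular x y ->
  smooth_at (fun w => root_metric a w.1 w.2) (x, y).
Proof. by have [A [_ [AE sA]]] := regular_open_set; move=> /AE[_ _ /sA]. Qed.

Hypothesis nondegenerate :
  forall x y, regular x y -> fundamental_mx a x y \in unitmx.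

Let partial_slice x j z : regular x z ->
  partial j (root_metric a x) z =
  'D_(0, basis_vec R j) (fun w : V * V => root_metric a w.1 w.2) (x, z).
Proof. by move=> rz; rewrite partialE derive_slice. Qed.

(* If [P] vanishes at [y] then so does [F], on the whole ray through [y]; hence
   [g_ij = F_i F_j] and [y] lies in its kernel. *)
Lemma regular_neq0 x y : regular x y -> P x y != 0.
Proof.
move=> rxy; apply/eqP => P0; have F0 := root_metric_eq0 _ _ P0.
have y0 : y <> 0 by have [_ []] := rxy.
pose F := root_metric a x; pose J (w : V * V) := root_metric a w.1 w.2.
have oU := open_regular_fiber x.
have dF z : regular x z -> differentiable F z.
  by move=> /regular_smooth/(_ [::]); exact: differentiable_slice.
(* [smooth_at] on the product, applied to the single direction [(0, e_j)], gives differentiability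
   of the first vertical derivative. *)
have ddF j z : regular x z -> partially_derivable (partial j F) z.
  move=> rz; pose h w := 'D_(0, basis_vec R j) J (x, w).
  have E w : regular x w -> h w = partial j F w.
    by move=> rw; rewrite partial_slice.
  have N : \near z, h z = partial j F z by exact: near_on oU _ _ E rz.
  apply: near_eq_partially_derivable N _.
  apply: differentiable_partially.
  apply: (@differentiable_slice _ _ (fun w => 'D_(0, basis_vec R j) J w)).
  exact: (regular_smooth _ _ rz [:: (0, basis_vec R j)]).
have pF z : regular x z -> partially_derivable F z.
  by move=> /dF; exact: differentiable_partially.
have d1 j z : regular x z -> partial j (sqF a x) z = 2 * (F z * partial j F z).
  move=> rz; rewrite (eq_partial j _ (fun z => F z * F z)); last first.
    by move=> w; rewrite /sqF expr2.
  by rewrite partialM; [ring|exact: pF|exact: pF].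
have gE i j : fundamental a i j x y = partial i F y * partial j F y.
  rewrite /fundamental /dy -/(partial _ _).
  have -> : 'D_(basis_vec R i) (dy j (sqF a) x) y =
      partial i (fun z => 2 * (F z * partial j F z)) y.
    have E z : regular x z -> dy j (sqF a) x z = 2 * (F z * partial j F z).
      by move=> rz; rewrite -d1// partialE.
    have N : \near y, dy j (sqF a) x y = 2 * (F y * partial j F y).
      exact: near_on oU _ _ E rxy.
    by rewrite partialE; exact: near_eq_derive N.
  rewrite partialZ; last by apply: partially_derivableM; [exact: pF|exact: ddF].
  rewrite partialM; [|exact: pF|exact: ddF].
  have Fy0 : F y = 0 by [].
  by rewrite Fy0; field.
(* This sum is the derivative of [F] along the line [t *: y + y], on which [F] is identically
   zero. *)
have eF : \sum_j partial j F y * y 0 j = 0.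
  transitivity ('D_y F y); last first.
    rewrite derive_line (_ : (fun t => _) = (fun=> 0)) ?derive1_cst//.
    apply: funext => t; rewrite -[X in _ + X]scale1r -scalerDl.
    apply: root_metric_eq0.
    by rewrite scaled_form_scale P0 mulr0.
  rewrite deriveE; last exact: dF.
  transitivity ('d F y (\sum_j y 0 j *: basis_vec R j)); last first.
    by congr ('d F y _); rewrite [RHS]row_sum_delta.
  rewrite linear_sum; apply: eq_bigr => j _.
  rewrite partialE deriveE; last exact: dF.
  rewrite mulrC; symmetry; exact: linearZ.
apply: y0; apply/rowP => j; rewrite mxE; move: j.
apply: (unitmx_mul_inj _ (nondegenerate _ _ rxy)) => i.
transitivity (partial i F y * \sum_j partial j F y * y 0 j).
  by rewrite mulr_sumr; apply: eq_bigr => j _; rewrite mxE gE mulrA.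
by rewrite eF mulr0.
Qed.

Let drat f (z : V) :
  rational_on classical_sets.setT f -> partially_derivable f z.
Proof. by move=> rf; exact: (rational_derivable _ openT _ _ rf). Qed.

Let rP x U : rational_on U (P x). Proof. exact: rational_form. Qed.
Let rQ x l U : rational_on U (Q x l). Proof. exact: rational_form. Qed.

(* [F^2 / P], up to the scaling of [P]. *)
Definition sqF_ratio x y : R := root_sq e (K * P x y) / P x y.
Local Notation lam := sqF_ratio.
Local Notation A := (2 * e - 1).

Lemma sqF_ratio_neq0 x y : regular x y -> lam x y != 0.
Proof.
move=> /regular_neq0 P0; rewrite mulf_neq0 ?invr_eq0//.
by apply: root_sq_neq0; rewrite mulf_neq0 ?hess_scale_neq0.
Qed.

Lemma partial_sqF x j z : regular x z ->
  partial j (sqF a x) z = lam x z * (2 * e * partial j (P x) z).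
Proof.
move=> rz; rewrite (eq_partial j _ _ _ (sqF_root_sq x)).
have [_ ->] := partial_root_sq e K (P x) z j hess_scale_neq0
  (drat _ _ (rP _ _)) (regular_neq0 _ _ rz).
by rewrite /lam; ring.
Qed.

Lemma dx_sqF x k z : regular x z ->
  dx k (sqF a) x z = lam x z * (2 * e * Q x k z).
Proof.
move=> rz; have Wx : W x by case: rz.
have [d E] := family_dx W _ _ x z scaled_coef_family Wx.
rewrite /dx -[LHS](partialE k (fun x' => sqF a x' z)).
rewrite (eq_partial k _ _ _ (fun x' => sqF_root_sq x' z)).
have [_ ->] := partial_root_sq e K (fun x' => P x' z) x k hess_scale_neq0
  d (regular_neq0 _ _ rz).
by rewrite E /lam -/(Q x k z); ring.
Qed.

Let partial_lamM x i (g : V -> R) z : regular x z -> partially_derivable g z ->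
  partially_derivable (fun z => lam x z * g z) z /\
  partial i (fun z => lam x z * g z) z =
  lam x z * (A / P x z * partial i (P x) z * g z + partial i g z).
Proof.
move=> rz dg; exact: (partial_root_sqM e K (P x) z i hess_scale_neq0
  (drat _ _ (rP _ _)) (regular_neq0 _ _ rz)).
Qed.

Lemma dy_dx_sqF x j k y : regular x y -> dy j (dx k (sqF a)) x y =
  lam x y * (2 * e *
    (A / P x y * partial j (P x) y * Q x k y + partial j (Q x k) y)).
Proof.
move=> rxy; have E z : regular x z ->
    dx k (sqF a) x z = lam x z * (2 * e * Q x k z).
  exact: dx_sqF.
rewrite /dy -[LHS](partialE j (dx k (sqF a) x)).
rewrite (eq_on_partial _ (open_regular_fiber x) _ _ y j E rxy).
have [//|_ ->] := partial_lamM x j (fun z => 2 * e * Q x k z) y rxy.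
  by apply: partially_derivableZ; exact: drat.
by rewrite partialZ; [ring|apply: drat; exact: rQ].
Qed.

(** This is [g_ij] divided by [F^2 / P]. The latter is a constant times a power of [|P|] up to sign,
    with exponent [A = 2 e - 1], which is where [A] comes from. *)
Definition fundamental_core i j x z : R :=
  e * (A * ((P x z)^-1 * (partial i (P x) z * partial j (P x) z))
    + hessian (P x) i j z).

Lemma fundamentalE i j x y : regular x y ->
  fundamental a i j x y = lam x y * fundamental_core i j x y.
Proof.
move=> rxy; have E z : regular x z ->
    dy j (sqF a) x z = lam x z * (2 * e * partial j (P x) z).
  by move=> rz; rewrite -partial_sqF// partialE.
rewrite /fundamental {1}/dy -[X in _ * X](partialE i (dy j (sqF a) x)).
rewrite (eq_on_partial _ (open_regular_fiber x) _ _ y i E rxy).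
have dPj := drat _ y (rational_partial _ openT _ j (rP x _)).
have [//|_ ->] := partial_lamM x i (fun z => 2 * e * partial j (P x) z) y rxy.
  exact: partially_derivableZ.
rewrite partialZ// /fundamental_core /hessian; field.
exact: regular_neq0.
Qed.

Let partial_gradient x r y : W x ->
  (m.+2%:R - 1) * partial r (P x) y = \sum_j y 0 j * hessian (P x) j r y.
Proof.
move=> Wx; have := homogeneous_partial classical_sets.setT openT m.+2%:R (P x) r
  (rP x _) (homogeneous_scaled_form _ _ Wx) y.
by rewrite /euler => <-.
Qed.

Let degree_neq1 : m.+2%:R - 1 != 0 :> R.
Proof. by rewrite subr_eq0 pnatr_eq1. Qed.

(** If the Hessian kills [v], then contraction with [y] and Euler's identity give [P_r v^r = 0].
    Both parts of [g] then kill [v]. *)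
Lemma scaled_hess_inj x y (v : 'I_n -> R) : regular x y ->
  (forall j, \sum_r hessian (P x) j r y * v r = 0) -> forall r, v r = 0.
Proof.
move=> rxy v0; have Wx : W x by case: rxy.
have Pv : \sum_r partial r (P x) y * v r = 0.
  apply: (mulfI degree_neq1); rewrite mulr0 mulr_sumr.
  under eq_bigr do rewrite mulrA partial_gradient// mulr_suml.
  rewrite exchange_big big1//= => j _.
  under eq_bigr do rewrite -mulrA.
  by rewrite -mulr_sumr v0 mulr0.
apply: (unitmx_mul_inj _ (nondegenerate _ _ rxy)) => i.
transitivity (lam x y * e * (A / P x y * partial i (P x) y *
    (\sum_r partial r (P x) y * v r) + \sum_r hessian (P x) i r y * v r)).
  rewrite mulr_sumr -big_split mulr_sumr; apply: eq_bigr => r _.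
  by rewrite mxE fundamentalE// /fundamental_core/=; ring.
by rewrite Pv v0 mulr0 addr0 mulr0.
Qed.

Lemma flag_mx_unit x y : regular x y -> flag_mx a x y \in unitmx.
Proof.
move=> rxy; have Wx : W x by case: rxy.
apply: mul_inj_unitmx => v v0; apply: (scaled_hess_inj x y) => // j.
rewrite -[RHS](v0 j); apply: eq_bigr => r _.
by rewrite mxE flag_metric_hessian.
Qed.

(** [spray] inverts [g], which contains the root, so its rationality is not visible. A rational [G]
    is built by inverting [h] instead; it satisfies the system, hence [spray_contraction], and this
    identity is what identifies it with [spray]. *)
Lemma scaled_spray_system x : W x ->
  spray_system (fun y : V => regular x y) m.+2 (P x) (Q x)
    (fun r => spray a r x).
Proof.
move=> Wx; pose U : set V := fun y : V => regular x y.
have oU : open U by exact: open_regular_fiber.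
pose S j (y : V) := \sum_k y 0 k * partial j (Q x k) y - Q x j y.
pose G r (y : V) := \sum_j invmx (flag_mx a x y) r j * (2^-1 * S j y).
have flagE : forall y, U y -> flag_mx a x y \in unitmx.
  by move=> y; exact: flag_mx_unit.
have rS j : rational_on U (S j).
  have rQx l := rQ x l U; apply: rationalB => //; apply: rational_sum => k _.
  by apply: rationalM; [exact: rational_coord|exact: rational_partial].
have rG r : rational_on U (G r).
  apply: rational_sum => j _; apply: rationalM.
    apply: rational_invmx => // i k.
    apply: (rational_ext U (hessian (P x) i k)).
      by apply: rational_partial => //; apply: rational_partial.
    by move=> y _; rewrite mxE flag_metric_hessian.
  by apply: rationalM => //; exact: rational_cst.
have sys : spray_system U m.+2 (P x) (Q x) G.
  split=> //.
  - exact: homogeneous_scaled_form.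
  - by move=> l; exact: homogeneous_scaled_form_dx.
  - by move=> y v; exact: scaled_hess_inj.
  - move=> y j Uy; rewrite -/(S j y).
    have := sum_mul_invmx _ (flagE _ Uy) (fun j => 2^-1 * S j y) j.
    under eq_bigr do rewrite mxE flag_metric_hessian//.
    by move=> ->; field.
have sprayE r y : U y -> spray a r x y = G r y.
  move=> Uy; rewrite /spray.
  (* With [G] written as [g^-1 (g G)], it remains to match [g G] with the Euler-Lagrange expression;
     [spray_contraction] matches the [P_i P_j] part of [g]. *)
  rewrite -[RHS](sum_invmx_mul _ (nondegenerate _ _ Uy) (fun r => G r y)).
  rewrite mulr_sumr; apply: eq_bigr => j _; rewrite mulrCA; congr (_ * _).
  have [_ _ _ _ _ _ _ /(_ y j Uy) E] := sys.
  have E' := spray_contraction U oU _ _ _ _ sys y Uy.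
  under eq_bigr do rewrite dy_dx_sqF//.
  rewrite dx_sqF//.
  transitivity (4^-1 * (lam x y * (2 * e * (A / P x y * partial j (P x) y *
      (\sum_k y 0 k * Q x k y) + S j y)))).
    have -> : \sum_k lam x y * (2 * e * (A / P x y * partial j (P x) y * Q x k y
          + partial j (Q x k) y)) * y 0 k =
        lam x y * (2 * e) * (A / P x y * partial j (P x) y *
          (\sum_k y 0 k * Q x k y) + \sum_k y 0 k * partial j (Q x k) y).
      rewrite mulr_sumr -big_split mulr_sumr.
      by apply: eq_bigr => k _ /=; ring.
    by rewrite /S; ring.
  rewrite /S -E -E' !mulr_sumr -big_split !mulr_sumr; apply: eq_bigr => k _ /=.
  rewrite mxE fundamentalE// /fundamental_core; field.
  exact: regular_neq0.
case: sys => p1 r1 r2 _ h1 h2 inj E; split=> //.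
  by move=> r; apply: (rational_ext U (G r)) => // y Uy; rewrite sprayE.
by move=> y j Uy; under eq_bigr do rewrite sprayE//; exact: E.
Qed.

Local Notation G x := (fun r => spray a r x).

Let hderivE l (f : coord_fun R n) x y : hderiv a l f x y =
  partial l (fun x' => f x' y) x
  - \sum_r partial l (spray a r x) y * partial r (f x) y.
Proof.
rewrite /hderiv /dx partialE; congr (_ - _).
by apply: eq_bigr => r _; rewrite /nonlinear /dy !partialE.
Qed.

Let dflagE x i j k y : W x ->
  dflag a i j k x y = partial k (hessian (P x) i j) y.
Proof.
move=> Wx; rewrite /dflag /dy -(partialE k (flag_metric a i j x)).
by apply: eq_partial => z; exact: flag_metric_hessian.
Qed.

Lemma hderiv_flag l i j x y : W x ->
  hderiv a l (flag_metric a i j) x y = hess_hderiv (P x) (Q x) (G x) l i j y.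
Proof.
move=> Wx; rewrite hderivE; congr (_ - _).
  have E z : W z -> flag_metric a i j z y = hessian (P z) i j y.
    exact: flag_metric_hessian.
  rewrite (eq_on_partial _ oW _ _ x l E Wx).
  by have [_ ->] := family_dx2 W oW _ _ i j x y scaled_coef_family Wx.
apply: eq_bigr => r _; congr (_ * _).
by apply: eq_partial => z; exact: flag_metric_hessian.
Qed.

Lemma hderiv_dflag l i j k x y : W x ->
  hderiv a l (dflag a i j k) x y = dhess_hderiv (P x) (Q x) (G x) l i j k y.
Proof.
move=> Wx; rewrite hderivE; congr (_ - _).
  have E z : W z -> dflag a i j k z y = partial k (hessian (P z) i j) y.
    exact: dflagE.
  rewrite (eq_on_partial _ oW _ _ x l E Wx).
  exact: (family_dx3 W oW _ _ k i j l x y scaled_coef_family Wx).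
apply: eq_bigr => r _; congr (_ * _).
by apply: eq_partial => z; exact: dflagE.
Qed.

Lemma berwaldE r j k x y : berwald a r j k x y = bcoef (G x) r j k y.
Proof. by rewrite /berwald /dy /bcoef unlock. Qed.

Lemma metrical_christoffel x y : regular x y -> forall s j k,
  \sum_i hessian (P x) s i y * metrical a i j k x y =
  2^-1 * (hess_hderiv (P x) (Q x) (G x) k s j y
    + hess_hderiv (P x) (Q x) (G x) j s k y
    - hess_hderiv (P x) (Q x) (G x) s j k y).
Proof.
move=> rxy s j k; have Wx : W x by case: rxy.
rewrite -!hderiv_flag//; pose X s := hderiv a k (flag_metric a s j) x y
  + hderiv a j (flag_metric a s k) x y - hderiv a s (flag_metric a j k) x y.
rewrite -[in RHS]/(X s) -(sum_mul_invmx _ (flag_mx_unit _ _ rxy) X) mulr_sumr.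
apply: eq_bigr => i _; rewrite mxE flag_metric_hessian// /metrical.
by rewrite mulrCA.
Qed.

Lemma hcov_cartan x y i j k l : regular x y -> hcov a (dflag a) i j k l x y =
  cartan_hcov (P x) (Q x) (G x) y (fun i j k => metrical a i j k x y) i j k l.
Proof.
move=> rxy; have Wx : W x by case: rxy.
rewrite /hcov hderiv_dflag// /cartan_hcov.
by congr (_ - _ - _ - _); apply: eq_bigr => r _; rewrite dflagE.
Qed.

Lemma hcov_contraction x y i j k : regular x y ->
  \sum_l hcov a (dflag a) i j k l x y * y 0 l =
  - landsberg (P x) (G x) i j k y.
Proof.
move=> rxy; have Wx : W x by case: rxy.
under eq_bigr do rewrite hcov_cartan//.
exact: (cartan_hcov_contraction _ (open_regular_fiber x) _ _ _ _
  (scaled_spray_system x Wx) _ _ rxy (metrical_christoffel _ _ rxy)).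
Qed.

(** Stated for arbitrary functions so that it serves twice: for [g_ij] as a function of [x] and as a
    function of [y]. *)
Let partial_core i (p pi pj pij : V -> R) z : p z != 0 ->
  partially_derivable p z -> partially_derivable pi z ->
  partially_derivable pj z -> partially_derivable pij z ->
  partial i (fun z => root_sq e (K * p z) / p z *
    (e * (A * ((p z)^-1 * (pi z * pj z)) + pij z))) z =
  root_sq e (K * p z) / p z * e *
   ((A / p z * (A / p z * pi z * pj z + pij z) - A / p z ^+ 2 * pi z * pj z)
      * partial i p z
    + A / p z * pj z * partial i pi z + A / p z * pi z * partial i pj z
    + partial i pij z).
Proof.
move=> p0 dp dpi dpj dpij.
have dV := partially_derivableV p z p0 dp.
have d1 := partially_derivableM _ _ _ dpi dpj.
have d2 := partially_derivableM _ _ _ dV d1.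
have d3 := partially_derivableZ A _ _ d2.
have d4 := partially_derivableD _ _ _ d3 dpij.
have [_ ->] := partial_root_sqM e K p z i hess_scale_neq0 dp p0 _
  (partially_derivableZ e _ _ d4).
rewrite partialZ// partialD// partialZ// partialM// partialM// partialV//.
by field.
Qed.

(** [g_ij] is a function of [P], [P_i], [P_j] and [h_ij]. Since [P_(;k) = 0] and
    [P_(i;k) = P_r G^r_ik], the gradient terms cancel against the Berwald terms, and [h_ij] leaves
    [e_ijk]. *)
Lemma landsberg_tensorE x y i j k : regular x y ->
  hderiv a k (fundamental a i j) x y
  - (\sum_r berwald a r i k x y * fundamental a r j x y)
  - (\sum_r berwald a r j k x y * fundamental a i r x y) =
  lam x y * e * landsberg (P x) (G x) i j k y.
Proof.
move=> rxy; have Wx : W x by case: rxy.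
have P0 := regular_neq0 _ _ rxy; have sys := scaled_spray_system x Wx.
have oU := open_regular_fiber x; have fam := scaled_coef_family.
have H0 := horizontal_constancy _ oU _ _ _ _ sys y k rxy.
have H1 s := horizontal_constancy1 _ oU _ _ _ _ sys y s k rxy.
have H2 := hess_hderivE _ oU _ _ _ _ sys k i j y rxy.
have Ex : partial k (fun x' => fundamental a i j x' y) x = lam x y * e *
   ((A / P x y * (A / P x y * partial i (P x) y * partial j (P x) y
        + hessian (P x) i j y)
      - A / P x y ^+ 2 * partial i (P x) y * partial j (P x) y) * Q x k y
    + A / P x y * partial j (P x) y * partial i (Q x k) y
    + A / P x y * partial i (P x) y * partial j (Q x k) y
    + partial i (partial j (Q x k)) y).
  have E z : regular z y ->
      fundamental a i j z y = lam z y * fundamental_core i j z y.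
    exact: fundamentalE.
  rewrite (eq_on_partial _ (open_regular_base y) _ _ x k E rxy).
  have [d0 e0] := family_dx W _ _ x y fam Wx.
  have [di ei] := family_dx1 W oW _ _ i x y fam Wx.
  have [dj ej] := family_dx1 W oW _ _ j x y fam Wx.
  have [dij eij] := family_dx2 W oW _ _ i j x y fam Wx.
  have e0' : Q x k y = partial k (fun x => P x y) x := esym (e0 k).
  have ei' : partial i (Q x k) y = partial k (fun x => partial i (P x) y) x.
    exact: esym (ei k).
  have ej' : partial j (Q x k) y = partial k (fun x => partial j (P x) y) x.
    exact: esym (ej k).
  have eij' : partial i (partial j (Q x k)) y =
      partial k (fun x => hessian (P x) i j y) x by exact: esym (eij k).
  rewrite e0' ei' ej' eij'.
  exact: (partial_core k (fun x => P x y) (fun x => partial i (P x) y)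
    (fun x => partial j (P x) y) (fun x => hessian (P x) i j y)
    x P0 d0 di dj dij).
have Ey r : partial r (fundamental a i j x) y = lam x y * e *
   ((A / P x y * (A / P x y * partial i (P x) y * partial j (P x) y
        + hessian (P x) i j y)
      - A / P x y ^+ 2 * partial i (P x) y * partial j (P x) y)
        * partial r (P x) y
    + A / P x y * partial j (P x) y * hessian (P x) i r y
    + A / P x y * partial i (P x) y * hessian (P x) j r y
    + partial r (hessian (P x) i j) y).
  have E z : regular x z ->
      fundamental a i j x z = lam x z * fundamental_core i j x z.
    exact: fundamentalE.
  rewrite (eq_on_partial _ oU _ _ y r E rxy).
  have rp s : rational_on classical_sets.setT (partial s (P x)).
    exact: (rational_partial _ openT).
  have hC s : hessian (P x) s r y = hessian (P x) r s y.
    exact: (partialC _ openT).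
  rewrite !hC; apply: partial_core => //; apply: drat => //.
  exact: (rational_partial _ openT).
rewrite hderivE Ex.
under eq_bigr do rewrite Ey.
under [X in _ - X - _]eq_bigr do
  rewrite berwaldE fundamentalE// /fundamental_core.
under [X in _ - _ - X]eq_bigr do
  rewrite berwaldE fundamentalE// /fundamental_core.
have -> : landsberg (P x) (G x) i j k y = partial i (partial j (Q x k)) y
  - \sum_r partial k (spray a r x) y * partial r (hessian (P x) i j) y
  - \sum_r hessian (P x) i r y * bcoef (G x) r j k y
  - \sum_r hessian (P x) j r y * bcoef (G x) r i k y.
  by rewrite -[X in X - _ - _]/(hess_hderiv (P x) (Q x) (G x) k i j y) H2; ring.
rewrite H0 !H1.
(* The coefficient of [P_(;k)]; it is kept opaque because it is multiplied by zero. *)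
pose c := A / P x y * (A / P x y * partial i (P x) y * partial j (P x) y
        + hessian (P x) i j y)
      - A / P x y ^+ 2 * partial i (P x) y * partial j (P x) y.
rewrite -/c.
have S (f1 f2 f3 f4 N : 'I_n -> R) (c1 c2 c4 : R) :
    \sum_r N r * (c4 * (c * f1 r + c1 * f2 r + c2 * f3 r + f4 r)) =
    c4 * (c * (\sum_r f1 r * N r) + c1 * (\sum_r f2 r * N r)
      + c2 * (\sum_r f3 r * N r) + \sum_r N r * f4 r).
  rewrite !mulr_sumr -!big_split mulr_sumr; apply: eq_bigr => r _ /=; ring.
rewrite S.
have T1 : \sum_r bcoef (G x) r i k y * (lam x y * (e * (A * ((P x y)^-1 *
     (partial r (P x) y * partial j (P x) y)) + hessian (P x) r j y))) =
   lam x y * e * (A / P x y * partial j (P x) y *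
     (\sum_r partial r (P x) y * bcoef (G x) r i k y)
    + \sum_r hessian (P x) j r y * bcoef (G x) r i k y).
  rewrite !mulr_sumr -!big_split mulr_sumr; apply: eq_bigr => r _ /=.
  by rewrite (hessC _ oU _ _ _ _ sys r j y rxy); ring.
have T2 : \sum_r bcoef (G x) r j k y * (lam x y * (e * (A * ((P x y)^-1 *
     (partial i (P x) y * partial r (P x) y)) + hessian (P x) i r y))) =
   lam x y * e * (A / P x y * partial i (P x) y *
     (\sum_r partial r (P x) y * bcoef (G x) r j k y)
    + \sum_r hessian (P x) i r y * bcoef (G x) r j k y).
  rewrite !mulr_sumr -!big_split mulr_sumr; apply: eq_bigr => r _ /=; ring.
by rewrite T1 T2 /bcoef; ring.
Qed.

Lemma fiber_landsbergP x y : regular x y ->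
  (forall i j k, hderiv a k (fundamental a i j) x y
    - (\sum_r berwald a r i k x y * fundamental a r j x y)
    - (\sum_r berwald a r j k x y * fundamental a i r x y) = 0) <->
  forall i j k, \sum_l hcov a (dflag a) i j k l x y * y 0 l = 0.
Proof.
move=> rxy; have c0 : lam x y * e != 0.
  by rewrite mulf_neq0 ?sqF_ratio_neq0// invr_eq0 pnatr_eq0.
split=> H i j k.
  have := H i j k; rewrite landsberg_tensorE// hcov_contraction// => /eqP.
  by rewrite mulf_eq0 (negbTE c0) => /eqP->; rewrite oppr0.
have := H i j k; rewrite landsberg_tensorE// hcov_contraction// => /eqP.
by rewrite oppr_eq0 => /eqP->; rewrite mulr0.
Qed.

Lemma fiber_berwaldP x : W x ->
  (forall y y', regular x y -> regular x y' -> forall i j k,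
    berwald a i j k x y = berwald a i j k x y') <->
  forall y, regular x y -> forall i j k l, hcov a (dflag a) i j k l x y = 0.
Proof.
move=> Wx; have oU := open_regular_fiber x.
have sys := scaled_spray_system x Wx.
split=> [ber y rxy i j k l|hc y y' ry ry' r j k].
  rewrite hcov_cartan//.
  apply: (bcurv_eq0_cartan_hcov _ oU _ _ _ _ sys _ _ rxy
    (metrical_christoffel _ _ rxy)) => z rz r p q s.
  (* Constancy on the open fibre makes the vertical derivative [bcurv] vanish. *)
  have E w : regular x w -> bcoef (G x) r q s w = bcoef (G x) r q s z.
    by move=> rw; rewrite -!berwaldE; exact: ber.
  by rewrite /bcurv (eq_on_partial _ oU _ _ z p E rz) partial_cst.
rewrite !berwaldE.
have rG : rational_on (fun y => regular x y) (spray a r x) by case: sys.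
(* Here [y] and [y'] may lie in different components of the fibre. *)
apply: (rational_constant _ oU) ry ry' => [|z rz i].
  by apply: (rational_partial _ oU); exact: (rational_partial _ oU).
rewrite -[LHS]/(bcurv (G x) r i j k z); move: r i j k {rG}.
apply: (cartan_hcov_eq0_bcurv _ oU _ _ _ _ sys _ _ rz
    (metrical_christoffel _ _ rz)) => [w rw i j k|i j k l].
  apply/eqP; rewrite -oppr_eq0 -hcov_contraction// big1// => l _.
  by rewrite hc// mul0r.
by rewrite -hcov_cartan// hc.
Qed.

End LocalForm.

Theorem corollary5 (R : realType) (n m : nat) (M : smooth_manifold R n)
    (a : symmetric_tensor M m.+2) (ha : is_root_metric_space a) :
  (is_berwald_space a <->
     forall (c : chart_index M) (x y : 'rV[R]_n), regular_in a c x y ->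
     forall i j k l : 'I_n, hcov (a c) (dflag (a c)) i j k l x y = 0) /\
  (is_landsberg_space a <->
     forall (c : chart_index M) (x y : 'rV[R]_n), regular_in a c x y ->
     forall i j k : 'I_n,
       \sum_(l < n) hcov (a c) (dflag (a c)) i j k l x y * y 0 l = 0).
Proof.
have oW (c : chart_index M) : open (chart_image c) := @open_image _ _ _ c.
have da (c : chart_index M) x I : chart_image c x ->
    differentiable (fun x' => a c x' I) x.
  by move=> Wx; exact: (smooth_comp a I Wx [::]).
have sa (c : chart_index M) x (I J : m.+2.-tuple 'I_n) :
    chart_image c x -> perm_eq I J -> a c x I = a c x J.
  exact: symmetric_comp.
have nd c := ha c.
have B c := fiber_berwaldP (a c) _ (oW c) (da c) (sa c) (nd c).
have L c := fiber_landsbergP (a c) _ (oW c) (da c) (sa c) (nd c).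
split; split.
- move=> H c x y r.
  exact: (proj1 (B c x (proj1 r)) (fun z z' => H c x z z') y r).
- move=> H c x y y' r r'.
  exact: (proj2 (B c x (proj1 r)) (fun z => H c x z) y y' r r').
- by move=> H c x y r; exact: (proj1 (L c x y r) (H c x y r)).
- by move=> H c x y r; exact: (proj2 (L c x y r) (H c x y r)).
Qed.
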